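(* Let $2\le m\le n-1$ and let $h_m:[n]\to[n]$ be the Hessenberg function $h_m=(m,n,\ldots,n)$, i.e. $h_m(1)=m$ and $h_m(j)=n$ for $2\le j\le n$. Then the singular locus of $\mathrm{Hess}(N,h_m)\cap\Omega_e^\circ$ is the set of all lower triangular unipotent $n\times n$ complex matrices $g=(x_{ij})$ (with $x_{ii}=1$ and $x_{ij}=0$ for $i<j$) such that $$x_{i1}=0\ \text{ for all }2\le i\le n\quad\text{and}\quad x_{nj}=0\ \text{ for all }2\le j\le m.$$
   Context: Write $[n]=\{1,\ldots,n\}$. $Fl(\mathbb{C}^n)$ is the variety of full flags $V_\bullet=(V_1\subset\cdots\subset V_n=\mathbb{C}^n)$, $\dim V_i=i$, identified with $\mathrm{GL}_n(\mathbb{C})/B$ ($B$ = upper triangular invertible matrices) by letting the first $j$ columns of $g$ span $V_j$. Let $N$ be the $n\times n$ nilpotent matrix consisting of a single Jordan block ($N_{i,i+1}=1$, all other entries $0$). For a nondecreasing $h:[n]\to[n]$ with $h(j)\ge j$ for all $j$ (a Hessenberg function), $$\mathrm{Hess}(N,h)=\{V_\bullet\in Fl(\mathbb{C}^n)\mid NV_i\subset V_{h(i)}\text{ for all }i\in[n]\},$$ a (reduced) closed subvariety. $\Omega_e^\circ$ is the opposite Schubert cell of the identity, i.e. the orbit of $eB$ under the group of lower triangular invertible matrices; it is an open affine subset of $Fl(\mathbb{C}^n)$, identified with the set of lower triangular unipotent $n\times n$ matrices, via $g\mapsto gB$. Under this identification, $$\mathrm{Hess}(N,h)\cap\Omega_e^\circ=\{g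 \text{ lower triangular unipotent}\mid (g^{-1}Ng)_{ij}=0\text{ for all }j\in[n-1],\ h(j)<i\le n\}.$$ *)

(* Defs.v *)
From HB Require Import structures.
From mathcomp Require Import all_boot all_order all_algebra.
From mathcomp Require Import mpoly complex.
From mathcomp Require Import classical_sets reals.

Set Implicit Arguments.
Unset Strict Implicit.
Unset Printing Implicit Defensive.

Import GRing.Theory.

Local Open Scope classical_set_scope.
Local Open Scope ring_scope.

Section AffineVarieties.

Variables (K : fieldType) (N : nat).
Implicit Types (X Z : set 'rV[K]_N) (p v : 'rV[K]_N).

Definition evalp (f : {mpoly K[N]}) p : K := f.@[fun k => p 0 k].

Definition zariski_closed Z : Prop :=
  exists S : set {mpoly K[N]}, Z = [set p | forall f, S f -> evalp f p = 0].

Definition zariski_irreducible Z : Prop :=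
  Z !=set0 /\
  forall A B, zariski_closed A -> zariski_closed B ->
    Z `<=` A `|` B -> Z `<=` A \/ Z `<=` B.

Definition vanishing_ideal X : set {mpoly K[N]} :=
  [set f | forall p, X p -> evalp f p = 0].

(* A strictly increasing chain c 0, ..., c d (so of length d) of irreducible
   closed subsets of X through p.  These correspond to the chains of prime
   ideals of the local ring of X at p (K algebraically closed, X closed). *)
Definition chain_at X p (d : nat) (c : nat -> set 'rV[K]_N) : Prop :=
  (forall i, (i <= d)%N ->
     [/\ zariski_closed (c i), zariski_irreducible (c i), c i `<=` X & c i p]) /\
  (forall i, (i < d)%N -> c i `<` c i.+1).

(* d is the Krull dimension of the local ring of X at p. *)
Definition local_dim X p (d : nat) : Prop :=
  (exists c, chain_at X p d c) /\
  (forall e c, chain_at X p e c -> (e <= d)%N).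

(* Zariski tangent space at p of X with its reduced structure: all the
   polynomials vanishing on X are used, not only chosen defining equations. *)
Definition tangent_space X p : set 'rV[K]_N :=
  [set v | forall f, vanishing_ideal X f ->
     \sum_(k < N) evalp (mderiv k f) p * v 0 k = 0].

Definition regular_point X p : Prop :=
  exists (d : nat) (T : {vspace 'rV[K]_N}),
    [/\ local_dim X p d, [set` T] = tangent_space X p & \dim T = d].

Definition singular_locus X : set 'rV[K]_N :=
  [set p | X p /\ ~ regular_point X p].

End AffineVarieties.

(* Indices follow the 1-based convention: a flag is V 1, ..., V n (the values
   of V outside of 1..n are irrelevant), a Hessenberg function is given by its
   values h 1, ..., h n, and the matrix entry x_ij is the entry of MathComp
   ordinals whose successors are i and j. *)
Section Hessenberg.

Variables (K : fieldType) (n : nat).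
Implicit Types (V : nat -> {vspace 'cV[K]_n}) (g A : 'M[K]_n).

Definition full_flag V : Prop :=
  (forall i, (1 <= i <= n)%N -> \dim (V i) = i) /\
  (forall i, (1 <= i < n)%N -> (V i <= V i.+1)%VS).

Definition Hess A (h : nat -> nat) : set (nat -> {vspace 'cV[K]_n}) :=
  [set V | full_flag V /\
     forall i, (1 <= i <= n)%N -> forall v, v \in V i -> A *m v \in V (h i)].

(* The flag of the coset gB. *)
Definition flag_of g (j : nat) : {vspace 'cV[K]_n} :=
  <<[seq col k g | k : 'I_n <- enum 'I_n & (k.+1 <= j)%N]>>%VS.

Definition regular_nilpotent : 'M[K]_n :=
  \matrix_(i < n, j < n) (i.+1 == j :> nat)%:R.

Definition lower_unipotent g : Prop :=
  (forall i : 'I_n, g i i = 1) /\ (forall i j : 'I_n, (i < j)%N -> g i j = 0).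

(* The intersection of Hess(A, h) with the opposite Schubert cell of the
   identity, in the coordinates g |-> gB on that cell. *)
Definition Hess_chart A h : set 'M[K]_n :=
  [set g | lower_unipotent g /\ Hess A h (flag_of g)].

Definition hess_fun (m j : nat) : nat := if j == 1%N then m else n.

(* n x n matrices are points of the affine space of dimension n * n through
   mxvec. *)
Definition matrix_singular_locus (X : set 'M[K]_n) : set 'M[K]_n :=
  [set g | singular_locus (mxvec @` X) (mxvec g)].

End Hessenberg.

Lemma col_mulmx (K : fieldType) m n p (A : 'M[K]_(m, n)) (B : 'M[K]_(n, p)) j :
  col j (A *m B) = A *m col j B.
Proof. by rewrite !colE mulmxA. Qed.

Lemma mem_flag_of (K : fieldType) n (g : 'M[K]_n) (j : nat) (v : 'cV[K]_n) :
  g \in unitmx ->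
  v \in flag_of g j <-> forall i : 'I_n, (j <= i)%N -> (invmx g *m v) i 0 = 0.
Proof.
move=> ug; split.
  set s := [seq col k g | k : 'I_n <- enum 'I_n & (k.+1 <= j)%N].
  move=> vs i ji; have /coord_span -> : v \in <<in_tuple s>>%VS by [].
  rewrite mulmx_sumr summxE big1 // => k _.
  rewrite -scalemxAr mxE.
  have : s`_k \in s by apply: mem_nth; rewrite ltn_ord.
  move=> /mapP [l]; rewrite mem_filter => /andP [lj _] ->.
  rewrite -col_mulmx mulVmx // !mxE.
  case: eqP => [il|]; last by rewrite mulr0.
  by move: ji; rewrite il leqNgt lj.
move=> H.
have -> : v = \sum_i (invmx g *m v) i 0 *: col i g.
  rewrite -{1}(mulKVmx ug v).
  apply/matrixP => a b; rewrite mxE summxE; apply: eq_bigr => k _.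
  by rewrite !ord1 !mxE mulrC.
apply: memv_suml => k _.
case: (ltnP k j) => kj; last by rewrite H // scale0r mem0v.
apply: memvZ; apply: memv_span; apply/mapP; exists k => //.
by rewrite mem_filter kj mem_enum.
Qed.

(* On lower unipotent matrices, membership in the chart is the vanishing of the
   entries (i, j) of g^-1 A g with h(j) < i. *)
Lemma Hess_chartE (K : fieldType) n (A g : 'M[K]_n) (h : nat -> nat) :
  (forall i j, (1 <= i <= j)%N -> (j <= n)%N -> (h i <= h j)%N) ->
  (forall i, (1 <= i <= n)%N -> (i <= h i <= n)%N) ->
  lower_unipotent g ->
  Hess_chart A h g <->
  forall i j : 'I_n, (h j.+1 < i.+1)%N -> (invmx g *m A *m g) i j = 0.
Proof.
move=> hmono hh lg.
have ug : g \in unitmx.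
  rewrite unitmxE det_trig ?big1 ?unitr1 //; first by case: lg.
  by apply/is_trig_mxP => i j; case: lg => _; apply.
split.
  move=> [_ [_ H]] i j hij.
  have /mem_flag_of : A *m col j g \in flag_of g (h j.+1).
    apply: (H j.+1); first exact: ltn_ord.
    apply: memv_span; apply/mapP; exists j => //.
    by rewrite mem_filter leqnn mem_enum.
  by move=> /(_ ug i hij); rewrite mulmxA -col_mulmx mxE.
move=> H; split => //; split.
  split.
    move=> i /andP[i0 iN].
    have fr : free [seq col k g | k : 'I_n <- enum 'I_n & (k.+1 <= i)%N].
      have fa : free [seq col k g | k : 'I_n <- enum 'I_n].
        rewrite -[[seq _ | _ <- _]]/(tval
          [tuple of [seq col k g | k : 'I_n <- ord_tuple n]]).
        apply/freeP => c hc k.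
        have : g *m (\col_l c l) = 0.
          rewrite -hc; apply/matrixP => a b; rewrite ord1 mxE summxE.
          apply: eq_bigr => l _; rewrite (nth_map l) ?size_enum_ord //.
          by rewrite nth_ord_enum !mxE mulrC.
        move=> /(congr1 (mulmx (invmx g))); rewrite mulmx0 mulKmx //.
        by move=> /matrixP /(_ k 0); rewrite !mxE.
      have := fa; rewrite -(perm_free (perm_map (fun k => col k g)
        (introT permPl (perm_filterC (fun k : 'I_n => (k.+1 <= i)%N) _)))).
      by rewrite map_cat => /catl_free.
    rewrite /flag_of; move/eqP: fr => ->; rewrite size_map size_filter.
    rewrite -sum1_count big_enum_cond /=.
    rewrite (big_ord_narrow iN) /= sum_nat_const card_ord muln1 //.
  move=> i _; apply: sub_span => v /mapP [k]; rewrite mem_filter => /andP [ki _] ->.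
  by apply/mapP; exists k => //; rewrite mem_filter ltnW // mem_enum.
move=> i /andP [i0 iN] v /(mem_flag_of _ _ ug) Hv; apply/mem_flag_of => // a ha.
have -> : invmx g *m (A *m v) = (invmx g *m A *m g) *m (invmx g *m v).
  by rewrite -!mulmxA; congr (_ *m (_ *m _)); rewrite mulKVmx.
rewrite mxE big1 // => k _.
case: (ltnP k i) => ki; last by rewrite Hv ?mulr0.
rewrite H ?mul0r // ltnS (leq_trans _ ha) //; exact: hmono.
Qed.

(* Main.v *)
Require Import Defs.
From mathcomp Require Import all_boot all_order all_algebra.
From mathcomp Require Import perm mpoly complex ring zify.
From mathcomp Require Import boolp classical_sets reals.

Set Implicit Arguments.
Unset Strict Implicit.
Unset Printing Implicit Defensive.

Import Order.TTheory GRing.Theory Num.Theory.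

Local Open Scope classical_set_scope.
Local Open Scope ring_scope.

(** Let [v_1, ..., v_n] be the columns of a lower unipotent [g = (x_ij)].  The only
    condition imposed by the Hessenberg function is that [N v_1] is a combination
    [\sum_(k <= m) c_k v_k], and the [c_k] are polynomials in [g].  Row by row this
    is the recurrence
      [x_(i+1,1) = c_1 x_(i,1) + \sum_(2 <= j <= m) c_j x_(i,j)],
    which expresses the first column through [c_1, ..., c_m] and the other
    columns; its last row, in which [x_(n+1,1) = 0], becomes
      [c_1 ^ n + \sum_(2 <= j <= m) c_j u_j = 0],
    with [u_j = \sum_i c_1 ^ (n - i) x_(i,j)].  Replacing the first column by the
    [c_k] and the entries [x_(n,j)] by the [u_j] is a polynomial change of
    coordinates ([straightenK], [unstraightenK]), so the chart is the product of
    an affine space and of this hypersurface.  There the gradient vanishes exactly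
    where all the [c_j] and [u_j] do; then [c_1 = 0] as well, so the first column
    of [g] is trivial and [u_j = x_(n,j)] ([straighten_singular]).
    Indices count from 1 in this comment and from 0
    below.

    Regularity is a statement about chains of irreducible closed sets and about
    all the functions vanishing on the variety, and polynomial isomorphisms
    preserve it ([iso_regular]).  On the hypersurface no vanishing ideal is
    computed: irreducible sets and tangent vectors are both obtained from
    polynomial curves ([closure_irreducible], [curve_tangent]).
    - No chain is longer than the number of free coordinates minus one
      ([model_chain_bound]): a chain of length [e] yields families of [t ^ e]
      independent functions of degree [O(t)] ([chain_growth]), while [c_1] is
      integral over the remaining coordinates.
    - Where some [c_j] or [u_j] is nonzero, the equation is solved for its partner
      by polynomial curves ([solve_curve]), which provide a chain of that length
      and a tangent space of that dimension ([model_regular]).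
    - Where all of them vanish, the tangent space contains every free direction,
      one too many ([model_singular]). *)

(** * Polynomials in several variables *)

Lemma mpoly_alg_ind (n : nat) (A : comNzRingType) (P : {mpoly A[n]} -> Prop) :
  (forall c, P c%:MP) -> (forall i, P 'X_i) ->
  (forall f g, P f -> P g -> P (f + g)) ->
  (forall f g, P f -> P g -> P (f * g)) -> forall f, P f.
Proof.
move=> PC PX PD PM f; elim/mpolyind: f => [|c m p _ _ Pp].
  by rewrite -mpolyC0; exact: PC.
apply: (PD) => //; rewrite -mul_mpolyC; apply: (PM); first exact: PC.
rewrite mpolyXE_id; apply: big_ind => [||i _].
- by rewrite -mpolyC1; exact: PC.
- by move=> f g; exact: PM.
elim: (m i) => [|k IH]; first by rewrite expr0 -mpolyC1; exact: PC.
by rewrite exprS; exact: PM.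
Qed.

(** The chain rule for an abstract derivation [d], which serves both for [deriv]
    on [{poly K}] (velocities of curves) and for [mderiv] on [{mpoly K[n]}]
    (differentials of polynomial maps). *)
Lemma derivation_mmap (A B : comNzRingType) (n : nat) (c : {rmorphism A -> B})
    (h : 'I_n -> B) (d : B -> B) :
  (forall x y, d (x + y) = d x + d y) ->
  (forall x y, d (x * y) = d x * y + x * d y) ->
  (forall a, d (c a) = 0) ->
  forall f, d (mmap c h f) = \sum_(k < n) mmap c h (mderiv k f) * d (h k).
Proof.
move=> dD dM dC; move=> f; elim/mpoly_alg_ind: f => [a|i|f g IHf IHg|f g IHf IHg].
- by rewrite mmapC dC big1 // => k _; rewrite mderivC mmap0 mul0r.
- rewrite mmapX mmap1U (bigD1 i) //= mderivX mnm1E eqxx scale1r.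
  have -> : (U_(i) - U_(i))%MM = 0%MM :> 'X_{1..n} by apply/mnmP => j; rewrite mnmBE subnn mnm0E.
  rewrite mpolyX0 rmorph1 mul1r big1 ?addr0 // => k ki.
  by rewrite mderivX mnm1E eq_sym (negPf ki) scale0r mmap0 mul0r.
- rewrite rmorphD dD IHf IHg -big_split; apply: eq_bigr => k _ /=.
  by rewrite mderivD rmorphD mulrDl.
- rewrite rmorphM dM IHf IHg mulr_suml mulr_sumr -big_split.
  apply: eq_bigr => k _ /=.
  by rewrite mderivM rmorphD !rmorphM /=; ring.
Qed.

Lemma rmorph_mmap (A B : comNzRingType) (n : nat) (c : {rmorphism A -> B})
    (h : 'I_n -> B) (e : {rmorphism B -> A}) :
  cancel c e -> forall f, e (mmap c h f) = f.@[fun k => e (h k)].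
Proof.
move=> cK; move=> f; elim/mpoly_alg_ind: f => [a|i|f g IHf IHg|f g IHf IHg].
- by rewrite mmapC cK mevalC.
- by rewrite mmapX mmap1U mevalXU.
- by rewrite !rmorphD /= IHf IHg.
- by rewrite !rmorphM /= IHf IHg.
Qed.

Section PolynomialFunctions.
Variables (K : fieldType) (N : nat).
Implicit Types (f g : {mpoly K[N]}) (p : 'rV[K]_N).

Lemma evalpC c p : evalp c%:MP p = c. Proof. exact: mevalC. Qed.
Lemma evalpX i p : evalp 'X_i p = p 0 i. Proof. exact: mevalXU. Qed.
Lemma evalpD f g p : evalp (f + g) p = evalp f p + evalp g p.
Proof. exact: mevalD. Qed.
Lemma evalpM f g p : evalp (f * g) p = evalp f p * evalp g p.
Proof. exact: mevalM. Qed.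
Lemma evalpB f g p : evalp (f - g) p = evalp f p - evalp g p.
Proof. exact: mevalB. Qed.

Definition polynomial_fun (F : 'rV[K]_N -> K) : Prop :=
  exists f, forall p, F p = evalp f p.

Lemma polynomial_cst c : polynomial_fun (fun=> c).
Proof. by exists c%:MP => p; rewrite evalpC. Qed.

Lemma polynomial_coord i : polynomial_fun (fun p => p 0 i).
Proof. by exists 'X_i => p; rewrite evalpX. Qed.

Lemma polynomialD F G : polynomial_fun F -> polynomial_fun G ->
  polynomial_fun (fun p => F p + G p).
Proof. by move=> [f Ff] [g Gg]; exists (f + g) => p; rewrite evalpD Ff Gg. Qed.

Lemma polynomialM F G : polynomial_fun F -> polynomial_fun G ->
  polynomial_fun (fun p => F p * G p).
Proof. by move=> [f Ff] [g Gg]; exists (f * g) => p; rewrite evalpM Ff Gg. Qed.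

Lemma polynomialB F G : polynomial_fun F -> polynomial_fun G ->
  polynomial_fun (fun p => F p - G p).
Proof. by move=> [f Ff] [g Gg]; exists (f - g) => p; rewrite evalpB Ff Gg. Qed.

Lemma polynomial_sum (I : Type) (r : seq I) (P : pred I) (F : I -> 'rV[K]_N -> K) :
  (forall i, polynomial_fun (F i)) ->
  polynomial_fun (fun p => \sum_(i <- r | P i) F i p).
Proof.
move=> PF; elim: r => [|i r [f Hf]].
  by exists 0 => p; rewrite big_nil /evalp meval0.
have [g Hg] := PF i; case: (boolP (P i)) => Pi.
  by exists (g + f) => p; rewrite big_cons Pi evalpD Hf Hg.
by exists f => p; rewrite big_cons (negPf Pi) Hf.
Qed.

Lemma polynomial_prod (I : Type) (r : seq I) (P : pred I) (F : I -> 'rV[K]_N -> K) :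
  (forall i, polynomial_fun (F i)) ->
  polynomial_fun (fun p => \prod_(i <- r | P i) F i p).
Proof.
move=> PF; elim: r => [|i r [f Hf]].
  by exists 1 => p; rewrite big_nil -mpolyC1 evalpC.
have [g Hg] := PF i; case: (boolP (P i)) => Pi.
  by exists (g * f) => p; rewrite big_cons Pi evalpM Hf Hg.
by exists f => p; rewrite big_cons (negPf Pi) Hf.
Qed.

Lemma polynomialXn F k : polynomial_fun F -> polynomial_fun (fun p => F p ^+ k).
Proof.
by move=> [f Hf]; exists (f ^+ k) => p; rewrite Hf /evalp rmorphXn.
Qed.

Lemma polynomial_det k (F : 'I_k -> 'I_k -> 'rV[K]_N -> K) :
  (forall i j, polynomial_fun (F i j)) ->
  polynomial_fun (fun p => \det (\matrix_(i, j) F i j p)).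
Proof.
move=> PF.
have [f Hf] : polynomial_fun
    (fun p => \sum_(s : 'S_k) (-1) ^+ s * \prod_i F i (s i) p).
  apply: polynomial_sum => s; apply: polynomialM; first exact: polynomial_cst.
  by apply: polynomial_prod.
exists f => p; rewrite -Hf; apply: eq_bigr => s _; congr (_ * _).
by apply: eq_bigr => i _; rewrite mxE.
Qed.

Lemma evalp_comp k (h : 'I_k -> {mpoly K[N]}) (f : {mpoly K[k]}) p :
  evalp (mmap (@mpolyC N K) h f) p = evalp f (\row_i evalp (h i) p).
Proof.
rewrite /evalp (@rmorph_mmap _ _ _ _ _ (meval _)).
  by apply: meval_eq => i; rewrite mxE.
by move=> a; exact: mevalC.
Qed.

Lemma mderiv_comp k (h : 'I_k -> {mpoly K[N]}) (f : {mpoly K[k]}) i :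
  mderiv i (mmap (@mpolyC N K) h f) =
  \sum_(j < k) mmap (@mpolyC N K) h (mderiv j f) * mderiv i (h j).
Proof.
apply: derivation_mmap.
- by move=> x y; rewrite mderivD.
- by move=> x y; rewrite mderivM.
- by move=> a; rewrite mderivC.
Qed.

End PolynomialFunctions.

(** * Polynomial curves *)

Section Curves.
Variables (K : numFieldType) (N : nat).
Implicit Types (X W : set 'rV[K]_N) (gam : 'I_N -> {poly K}).

Definition curve_at gam (t : K) : 'rV[K]_N := \row_k (gam k).[t].

Lemma poly_eq0_on_cofinite (P h : {poly K}) :
  h != 0 -> (forall t, h.[t] != 0 -> P.[t] = 0) -> P = 0.
Proof.
move=> h0 HP; apply/eqP; case: (eqVneq (h * P) 0) => [/eqP|hP].
  by rewrite mulf_eq0 (negPf h0).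
have := @max_poly_roots K _ [seq k%:R | k <- iota 0 (size (h * P))] hP.
rewrite size_map size_iota ltnn map_inj_uniq ?iota_uniq; last first.
  by move=> i j /eqP; rewrite eqr_nat => /eqP.
suff -> : all (root (h * P)) [seq k%:R | k <- iota 0 (size (h * P))].
  by move=> /(_ isT isT).
apply/allP => _ /mapP[k _ ->]; rewrite rootM; case: (boolP (root h _)) => //= hk.
by rewrite rootE HP.
Qed.

Lemma evalp_curve gam (f : {mpoly K[N]}) t :
  (mmap (@polyC K) gam f).[t] = evalp f (curve_at gam t).
Proof.
rewrite -[LHS]/(horner_eval t _) (@rmorph_mmap _ _ _ _ _ (horner_eval t)).
  by apply: meval_eq => k; rewrite mxE.
by move=> a; rewrite /= /horner_eval hornerC.
Qed.

(** A function vanishing on a curve contained in [X] has a zero derivative along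
    it, so the velocity is tangent to the reduced variety [X]; no generator of
    the vanishing ideal has to be known. *)
Lemma curve_tangent X gam : (forall t, X (curve_at gam t)) ->
  tangent_space X (curve_at gam 0) (\row_k ((gam k)^`()).[0]).
Proof.
move=> Xg f If.
have f0 : mmap (@polyC K) gam f = 0.
  apply: (@poly_eq0_on_cofinite _ 1); first exact: oner_neq0.
  by move=> t _; rewrite evalp_curve; apply: If.
have := @derivation_mmap K {poly K} N (@polyC K) gam (@deriv K)
  (@derivD K) (@derivM K) (@derivC K) f.
rewrite f0 deriv0 => /(congr1 (horner^~ 0)); rewrite hornerE => /esym.
rewrite horner_sum => E; rewrite -[RHS]E; apply: eq_bigr => k _.
by rewrite hornerM evalp_curve mxE.
Qed.

Definition zariski_closure W : set 'rV[K]_N :=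
  [set p | forall f, vanishing_ideal W f -> evalp f p = 0].

Lemma sub_closure W : W `<=` zariski_closure W.
Proof. by move=> p Wp f; apply. Qed.

Lemma closure_min W A : zariski_closed A -> W `<=` A -> zariski_closure W `<=` A.
Proof.
by move=> [S ->] WA p Wp f Sf; apply: Wp => q /WA; apply.
Qed.

Lemma closure_closed W : zariski_closed (zariski_closure W).
Proof. by exists (vanishing_ideal W). Qed.

(** If [f] does not vanish at [p] nor [g] at [q], then [f * g] does not vanish
    identically on a curve through [p] and [q]: rational connectedness of [W]
    replaces the primality of its vanishing ideal. *)
Lemma closure_irreducible W : W !=set0 ->
  (forall p q, W p -> W q -> exists gam (h : {poly K}),
     [/\ curve_at gam 0 = p, curve_at gam 1 = q, h != 0 &
         forall t, h.[t] != 0 -> W (curve_at gam t)]) ->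
  zariski_irreducible (zariski_closure W).
Proof.
move=> [w Ww] Wc; split; first by exists w; apply: sub_closure.
move=> A B [SA ->] [SB ->] WAB.
apply: contrapT => /not_orP[nA nB].
have ex S : ~ (zariski_closure W `<=` [set p | forall f, S f -> evalp f p = 0]) ->
    exists f p, [/\ S f, W p & evalp f p != 0].
  move=> nS; apply: contrapT => nex; apply: nS => p Wp f Sf; apply: Wp => q Wq.
  by apply/eqP; apply: contrapT => /negP fq; apply: nex; exists f, q.
have [f [p [Sf Wp fp]]] := ex _ nA; have [g [q [Sg Wq gq]]] := ex _ nB.
have [gam [h [g0 g1 h0 Wg]]] := Wc p q Wp Wq.
pose c := mmap (@polyC K) gam.
have : c f * c g = 0 :> {poly K}.
  apply: (poly_eq0_on_cofinite h0) => t ht; have Wt := Wg t ht; rewrite hornerM !evalp_curve.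
  have [At|Bt] := WAB _ (sub_closure Wt); first by rewrite (At f) ?mul0r.
  by rewrite (Bt g) ?mulr0.
move=> /eqP; rewrite mulf_eq0 => /orP[] /eqP c0.
- by move: fp; rewrite -g0 -evalp_curve -/c c0 horner0 eqxx.
- by move: gq; rewrite -g1 -evalp_curve -/c c0 horner0 eqxx.
Qed.

End Curves.

(** * Polynomial isomorphisms preserve regular points *)

Section PolynomialMaps.
Variables (K : fieldType) (N M : nat) (P : 'I_M -> {mpoly K[N]}).
Implicit Types (X : set 'rV[K]_N) (Y Z : set 'rV[K]_M).

Definition poly_map (p : 'rV[K]_N) : 'rV[K]_M := \row_k evalp (P k) p.

Definition jacobian (p : 'rV[K]_N) : 'M[K]_(N, M) :=
  \matrix_(i, k) evalp (mderiv i (P k)) p.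

Definition comp_poly_map (f : {mpoly K[M]}) : {mpoly K[N]} :=
  mmap (@mpolyC N K) P f.

Lemma evalp_comp_map f p : evalp (comp_poly_map f) p = evalp f (poly_map p).
Proof. exact: evalp_comp. Qed.

Lemma closed_preimage Z : zariski_closed Z -> zariski_closed (poly_map @^-1` Z).
Proof.
move=> [S ->]; exists (comp_poly_map @` S); apply/seteqP; split => p Zp.
  by move=> _ [f Sf <-]; rewrite evalp_comp_map; exact: Zp.
by move=> f Sf; rewrite -evalp_comp_map; apply: Zp; exists f.
Qed.

Lemma irreducible_image X :
  zariski_irreducible X -> zariski_irreducible (poly_map @` X).
Proof.
move=> [[x Xx] irrX]; split; first by exists (poly_map x), x.
move=> A B cA cB XAB.
have [|XA|XB] := irrX _ _ (closed_preimage cA) (closed_preimage cB).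
- by move=> p Xp; apply: XAB; exists p.
- by left => _ [p Xp <-]; exact: XA.
- by right => _ [p Xp <-]; exact: XB.
Qed.

Lemma differential_comp f p (v : 'rV[K]_N) :
  \sum_(i < N) evalp (mderiv i (comp_poly_map f)) p * v 0 i =
  \sum_(k < M) evalp (mderiv k f) (poly_map p) * (v *m jacobian p) 0 k.
Proof.
under eq_bigr => i _.
  rewrite mderiv_comp /evalp raddf_sum /= mulr_suml.
  under eq_bigr => k _ do rewrite -/(evalp _ p) evalpM evalp_comp_map -mulrA.
  over.
rewrite exchange_big; apply: eq_bigr => k _ /=.
rewrite -mulr_sumr mxE; congr (_ * _); apply: eq_bigr => i _.
by rewrite mxE mulrC.
Qed.

Lemma tangent_map X Y p v : (forall q, X q -> Y (poly_map q)) ->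
  tangent_space X p v -> tangent_space Y (poly_map p) (v *m jacobian p).
Proof.
move=> XY Tv f If; rewrite -differential_comp; apply: Tv => q Xq.
by rewrite evalp_comp_map; exact/If/XY.
Qed.

End PolynomialMaps.

Lemma poly_mapP (K : fieldType) (N M : nat) (F : 'rV[K]_N -> 'rV[K]_M) :
  (forall k, polynomial_fun (fun p => F p 0 k)) -> exists P, F =1 poly_map P.
Proof.
move=> /fin_all_exists[P HP]; exists P => p; apply/rowP => k.
by rewrite mxE -HP.
Qed.

Lemma closed_setI (K : fieldType) (N : nat) (A B : set 'rV[K]_N) :
  zariski_closed A -> zariski_closed B -> zariski_closed (A `&` B).
Proof.
move=> [S ->] [S' ->]; exists (S `|` S'); apply/seteqP; split => p.
  by move=> [Sp S'p] f [Sf|S'f]; [exact: Sp|exact: S'p].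
by move=> Sp; split=> f Sf; apply: Sp; [left|right].
Qed.

Lemma chain_subset (K : fieldType) (N : nat) (X : set 'rV[K]_N) p d c :
  chain_at X p d c -> forall i, (i <= d)%N -> c i `<=` X.
Proof. by move=> [H _] i /H[]. Qed.

Section Isomorphism.
Variables (K : fieldType) (N M : nat).
Variables (P : 'I_M -> {mpoly K[N]}) (Q : 'I_N -> {mpoly K[M]}).
Variables (X : set 'rV[K]_N) (Y : set 'rV[K]_M).
Hypothesis (XY : forall p, X p -> Y (poly_map P p) /\ poly_map Q (poly_map P p) = p).
Hypothesis (YX : forall q, Y q -> X (poly_map Q q) /\ poly_map P (poly_map Q q) = q).

(** [X] is cut out by the closed conditions [P p \in Y] and [Q (P p) = p]. *)
Lemma iso_closed : zariski_closed Y -> zariski_closed X.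
Proof.
move=> cY.
have -> : X = (poly_map P @^-1` Y) `&` [set p | poly_map Q (poly_map P p) = p].
  apply/seteqP; split => p; first exact: XY.
  by move=> [Yp <-]; have [] := YX Yp.
apply: closed_setI; first exact: closed_preimage.
exists (range (fun k => comp_poly_map P (Q k) - 'X_k)); apply/seteqP; split => p.
  move=> E _ [k _ <-]; rewrite evalpB evalp_comp_map evalpX -{2}E.
  by rewrite [poly_map Q _ _ _]mxE subrr.
move=> H; apply/rowP => k; rewrite mxE; apply/eqP; rewrite -subr_eq0.
by rewrite -(evalpX k p) -evalp_comp_map -evalpB; apply/eqP/H; exists k.
Qed.

(** The image by [P] of a closed subset of [X] is closed because it is also the
    preimage by [Q] within [Y]. *)
Lemma iso_chain p d c : zariski_closed Y -> chain_at X p d c ->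
  chain_at Y (poly_map P p) d (fun i => poly_map P @` c i).
Proof.
move=> cY ch; have sub := chain_subset ch; case: ch => [H str].
have imE i : (i <= d)%N -> poly_map P @` c i = Y `&` poly_map Q @^-1` c i.
  move=> id; apply/seteqP; split => q.
    move=> [r cr <-]; have [Yr rE] := XY (sub i id r cr).
    by split => //=; rewrite rE.
  move=> [Yq cq]; exists (poly_map Q q) => //.
  by have [] := YX Yq.
split => [i id|i id]; first have [cl irr cX cp] := H i id.
  split.
  - by rewrite imE //; apply: closed_setI => //; exact: closed_preimage.
  - exact: irreducible_image.
  - by rewrite imE // => q [].
  - by exists p.
have [s ns] := str i id; split.
  by move=> _ [r cr <-]; exists r => //; exact: s.
move=> sub'; apply: ns => r cr.
have [r' cr' E] : (poly_map P @` c i) (poly_map P r) by apply: sub'; exists r.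
have [_ <-] := XY (sub _ id _ cr); rewrite -E.
by have [_ ->] := XY (sub _ (ltnW id) _ cr').
Qed.

(** The coordinates of [Q o P - id] vanish on [X], so tangent vectors see the
    differential of [Q o P] as the identity even though [Q o P] may differ from
    the identity off [X]. *)
Lemma jacobianK p v : X p -> tangent_space X p v ->
  v *m jacobian P p *m jacobian Q (poly_map P p) = v.
Proof.
move=> Xp Tv; apply/rowP => k.
have /Tv : vanishing_ideal X (comp_poly_map P (Q k) - 'X_k).
  move=> q Xq; rewrite evalpB evalp_comp_map evalpX.
  by have [_ /rowP/(_ k)] := XY Xq; rewrite mxE => ->; rewrite subrr.
under eq_bigr => i _ do rewrite mderivB evalpB mulrBl.
rewrite sumrB differential_comp => /eqP; rewrite subr_eq0 => /eqP E.
rewrite mxE; under eq_bigr => j _ do rewrite [jacobian Q _ _ _]mxE mulrC.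
rewrite E (bigD1 k) //= mderivX mnm1E eqxx scale1r.
have -> : (U_(k) - U_(k))%MM = 0%MM :> 'X_{1..N}.
  by apply/mnmP => j; rewrite mnmBE subnn mnm0E.
rewrite mpolyX0 -mpolyC1 evalpC mul1r big1 ?addr0 // => i ik.
by rewrite mderivX mnm1E eq_sym (negPf ik) scale0r /evalp meval0 mul0r.
Qed.

End Isomorphism.

Lemma iso_regular (K : fieldType) (N M : nat)
    (P : 'I_M -> {mpoly K[N]}) (Q : 'I_N -> {mpoly K[M]}) X Y :
  (forall p, X p -> Y (poly_map P p) /\ poly_map Q (poly_map P p) = p) ->
  (forall q, Y q -> X (poly_map Q q) /\ poly_map P (poly_map Q q) = q) ->
  zariski_closed X -> zariski_closed Y ->
  forall p, X p -> regular_point X p -> regular_point Y (poly_map P p).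
Proof.
move=> XY YX cX cY p Xp [d [T [[[c hc] hmax] TX dT]]].
have [Yp pE] := XY _ Xp.
pose D : 'Hom('rV[K]_N, 'rV[K]_M) := linfun (mulmxr (jacobian P p)).
have DE v : D v = v *m jacobian P p by rewrite lfunE.
have memT v : v \in T <-> tangent_space X p v by rewrite -TX.
exists d, (D @: T)%VS; split.
- split; first by exists (fun i => poly_map P @` c i); exact: iso_chain XY YX _ _ _ cY hc.
  move=> e c' hc'; have := iso_chain YX XY cX hc'; rewrite pE.
  by move/hmax.
- apply/seteqP; split => w /=.
    move=> /memv_imgP[v /memT Tv ->]; rewrite DE.
    by apply: tangent_map Tv => q /XY[].
  move=> Tw; apply/memv_imgP; exists (w *m jacobian Q (poly_map P p)).
    apply/memT; rewrite -{1}pE.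
    by apply: tangent_map Tw => q /YX[].
  by rewrite DE -{2}pE (jacobianK YX).
- rewrite limg_dim_eq //; apply/eqP; rewrite -subv0; apply/subvP => v.
  rewrite memv_cap memv_ker DE => /andP[/memT Tv /eqP v0].
  by rewrite memv0 -(jacobianK XY Xp Tv) v0 mul0mx.
Qed.

(** * Chains of irreducible sets and the growth of function spaces *)

Section ChainGrowth.
Variables (K : fieldType) (N : nat).
Implicit Types (f g : {mpoly K[N]}) (X : set 'rV[K]_N) (p : 'rV[K]_N).

Lemma msizeM_bound f g a b :
  (msize f <= a.+1)%N -> (msize g <= b.+1)%N -> (msize (f * g) <= (a + b).+1)%N.
Proof.
have [-> _ _|f0] := eqVneq f 0; first by rewrite mul0r msize0.
have [-> _ _|g0] := eqVneq g 0; first by rewrite mulr0 msize0.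
rewrite msizeM // => fa gb; rewrite -subn1 leq_subLR.
by apply: leq_trans (leq_add fa gb) _; rewrite addSn addnS.
Qed.

Lemma msizeX_bound f a k : (msize f <= a.+1)%N -> (msize (f ^+ k) <= (k * a).+1)%N.
Proof.
move=> fa; elim: k => [|k IH]; first by rewrite expr0 msize1.
by rewrite exprS mulSn; apply: msizeM_bound.
Qed.

Lemma irreducible_mul (Z : set 'rV[K]_N) f g : zariski_irreducible Z ->
  (forall q, Z q -> evalp f q * evalp g q = 0) ->
  (exists2 q, Z q & evalp f q != 0) -> forall q, Z q -> evalp g q = 0.
Proof.
move=> [_ irr] fg0 [q0 Zq0 fq0] q Zq.
have cl (h : {mpoly K[N]}) : zariski_closed [set x | evalp h x = 0].
  exists [set h]; apply/seteqP; split => x; first by move=> hx _ ->.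
  exact.
have [|Zf|Zg] := irr _ _ (cl f) (cl g).
- by move=> x Zx; have /eqP := fg0 x Zx; rewrite mulf_eq0 => /orP[] /eqP; [left|right].
- by move: fq0; rewrite Zf ?eqxx.
- exact: Zg.
Qed.

(** Lower bound for the Hilbert function of the top of a chain.  Each step of the
    chain provides a polynomial [f] vanishing on the smaller set but not on the
    larger; a shortest relation between the [f ^+ k * G i] can be divided by a
    power of [f] by irreducibility, and then restricted to the smaller set, where
    only its lowest term survives.  So each step multiplies the size of an
    independent family by [t]. *)
Lemma chain_growth X p e c : chain_at X p e c ->
  exists C, forall t, exists (I : finType) (G : I -> {mpoly K[N]}),
    [/\ #|I| = (t ^ e)%N, forall i, (msize (G i) <= (C * t).+1)%N &
        forall r : I -> K,
          (forall q, c e q -> \sum_i r i * evalp (G i) q = 0) -> forall i, r i = 0].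
Proof.
elim: e => [|e IH] ch.
  exists 0%N => t; exists unit, (fun=> 1); split => [|i|r rp []].
  - by rewrite card_unit.
  - by rewrite msize1.
  have [_ _ _ cp] := ch.1 _ (leqnn 0).
  have := rp p cp; rewrite (big_pred1 tt); last by case.
  by rewrite -mpolyC1 evalpC mulr1.
have [C HC] : exists C, forall t, exists (I : finType) (G : I -> {mpoly K[N]}),
    [/\ #|I| = (t ^ e)%N, forall i, (msize (G i) <= (C * t).+1)%N &
        forall r : I -> K,
          (forall q, c e q -> \sum_i r i * evalp (G i) q = 0) -> forall i, r i = 0].
  by apply: IH; split=> i ie; [apply: ch.1|apply: ch.2]; rewrite ltnW ?ltnS.
have [[S cS] _ _ _] := ch.1 e (leqnSn e).
have [_ irr _ _] := ch.1 e.+1 (leqnn _).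
have [f fe [q0 cq0 fq0]] : exists2 f, vanishing_ideal (c e) f &
    exists2 q, c e.+1 q & evalp f q != 0.
  apply: contrapT => nf; have [_] := ch.2 e (leqnn _); apply => q cq.
  rewrite cS => f Sf; apply/eqP; apply: contrapT => /negP fq; apply: nf.
  by exists f; [rewrite cS => x; exact|exists q].
exists (C + msize f)%N => t; have [I [G [cI sG freeG]]] := HC t.
exists ('I_t * I)%type, (fun ki : 'I_t * I => f ^+ ki.1 * G ki.2); split.
- by rewrite card_prod card_ord cI expnS.
- move=> [k i] /=; rewrite mulnDl addnC.
  apply: leq_trans (msizeM_bound (msizeX_bound k (leqnSn (msize f))) (sG i)) _.
  by rewrite ltnS leq_add2r mulnC leq_mul2l ltnW ?orbT.
move=> r rel.
suff H j : forall k : 'I_t, (k < j)%N -> forall i, r (k, i) = 0.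
  by move=> [k i]; exact: (H k.+1).
elim: j => [//|j IHj] k; rewrite ltnS leq_eqVlt => /orP[/eqP kj|]; last exact: IHj.
pose h := \sum_(l < t | (j <= l)%N) \sum_i (r (l, i))%:MP * (f ^+ (l - j) * G i).
have hE q : evalp h q =
    \sum_(l < t | (j <= l)%N) \sum_i r (l, i) * (evalp f q ^+ (l - j) * evalp (G i) q).
  rewrite /evalp raddf_sum; apply: eq_bigr => l _.
  rewrite raddf_sum; apply: eq_bigr => i _.
  by rewrite /= !mevalM mevalC rmorphXn.
have h0 q : c e.+1 q -> evalp h q = 0.
  move: q; apply: (irreducible_mul (f := f ^+ j)) irr _ _; last first.
    by exists q0 => //; rewrite /evalp rmorphXn expf_neq0.
  move=> q cq; rewrite -[RHS](rel q cq) hE mulr_sumr.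
  rewrite [RHS](eq_bigr (fun li : 'I_t * I =>
    r (li.1, li.2) * (evalp f q ^+ li.1 * evalp (G li.2) q))); last first.
    by move=> [l i] _; rewrite evalpM /evalp rmorphXn.
  rewrite -(pair_bigA _ (fun l i => r (l, i) * (evalp f q ^+ (l : 'I_t) * evalp (G i) q))) /=.
  rewrite [RHS](bigID (fun l : 'I_t => (j <= l)%N)) /= [X in _ + X]big1 ?addr0; last first.
    by move=> l; rewrite -ltnNge => lj; apply: big1 => i _; rewrite IHj ?mul0r.
  apply: eq_bigr => l jl; rewrite mulr_sumr; apply: eq_bigr => i _.
  rewrite {1}/evalp rmorphXn -/(evalp f q) mulrCA; congr (_ * _).
  by rewrite mulrA -exprD subnKC.
move=> i; apply: (freeG (fun i => r (k, i))) i => q cq.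
have := h0 q ((ch.2 e (leqnn _)).1 q cq).
rewrite hE (bigD1 k) ?kj //= [X in _ + X]big1 ?addr0; last first.
  move=> l /andP[jl lk]; apply: big1 => i _; rewrite (fe q cq) expr0n.
  have -> : (l - j == 0)%N = false; last by rewrite mul0r mulr0.
  by apply/negbTE; rewrite subn_eq0 -ltnNge ltn_neqAle jl andbT -kj eq_sym.
move=> hq; rewrite -[RHS]hq; by apply: eq_bigr => i _; rewrite ?kj subnn expr0 mul1r.
Qed.

End ChainGrowth.

(** * The hypersurface [z ^ d + \sum_j a_j b_j = 0]: dimension *)

Lemma linear_relation (K : fieldType) (I B : finType) (A : I -> B -> K) :
  (#|B| < #|I|)%N ->
  exists2 r : I -> K, exists i, r i != 0 & forall b, \sum_i r i * A i b = 0.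
Proof.
move=> BI; pose M : 'M[K]_(#|I|, #|B|) := \matrix_(i, b) A (enum_val i) (enum_val b).
have : kermx M != 0.
  rewrite kermx_eq0 /row_free neq_ltn.
  by rewrite (leq_ltn_trans (rank_leq_col M) BI).
move=> /rowV0Pn[u /sub_kermxP uM u0].
exists (fun i => u 0 (enum_rank i)) => [|b].
  have /rV0Pn[i ui] := u0; exists (enum_val i); by rewrite enum_valK.
have /rowP/(_ (enum_rank b)) := uM; rewrite mxE [RHS]mxE => E; rewrite -[RHS]E.
rewrite (reindex (@enum_val I I)) /=; last exact/onW_bij/enum_val_bij.
by apply: eq_bigr => i _; rewrite enum_valK mxE enum_rankK.
Qed.

Lemma exp_outgrows (a b k e : nat) : (k < e)%N ->
  exists t, (a * (b * t).+1 ^ k < t ^ e)%N.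
Proof.
move=> ke; pose t := (a * b.+1 ^ k).+1; exists t.
have bt : (b * t < b.+1 * t)%N by rewrite ltn_pmul2r.
apply: (@leq_ltn_trans (a * (b.+1 * t) ^ k)).
  by rewrite leq_mul2l; case: (k) => [|k']; rewrite ?expn0 ?leqnn ?leq_exp2r ?bt ?orbT.
rewrite expnMn mulnA; apply: (@leq_trans (t ^ k.+1)); last by rewrite leq_pexp2l.
by rewrite expnS ltn_pmul2r ?expn_gt0.
Qed.

Section Model.
Variables (K : numFieldType) (N d : nat) (J : finType).
Variables (S : {set 'I_N}) (base : 'rV[K]_N) (z : 'I_N) (al be : J -> 'I_N).
Hypotheses (alS : forall j, al j \in S) (beS : forall j, be j \in S).
Hypotheses (zal : forall j, z != al j) (zbe : forall j, z != be j).
Hypothesis d_gt1 : (1 < d)%N.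
Implicit Types (p q : 'rV[K]_N).

Definition quadric p : K := p 0 z ^+ d + \sum_j p 0 (al j) * p 0 (be j).

(** The coordinates outside [S] are frozen, so that a variety given inside a
    larger matrix space is covered without reindexing. *)
Definition model : set 'rV[K]_N :=
  [set p : 'rV[K]_N | (forall k, k \notin S -> p 0 k = base 0 k) /\ quadric p = 0].

Lemma quadric_polynomial : polynomial_fun quadric.
Proof.
apply: polynomialD; first exact/polynomialXn/polynomial_coord.
by apply: polynomial_sum => j; apply: polynomialM; exact: polynomial_coord.
Qed.

Lemma model_closed : zariski_closed model.
Proof.
have [f Hf] := quadric_polynomial.
exists ([set f] `|` ((fun k => 'X_k - (base 0 k)%:MP) @` [set k | k \notin S])).
apply/seteqP; split => p.
  move=> [pb p0] g [->|[k kS <-]]; first by rewrite -Hf.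
  by rewrite evalpB evalpX evalpC pb // subrr.
move=> H; split; last by rewrite Hf; apply: H; left.
move=> k kS; apply/eqP; rewrite -subr_eq0; apply/eqP.
rewrite -(evalpX k p) -(evalpC (base 0 k) p) -evalpB.
by apply: H; right; exists k.
Qed.

(** The coordinates other than [z], over which [z] is integral. *)
Let T : finType := {k : 'I_N | k \in S :\ z}.

Let monomial (i : nat) (e : T -> nat) p := p 0 z ^+ i * \prod_(k : T) p 0 (val k) ^+ e k.

(** Functions are compared on the model only, so this is a subspace of its
    coordinate ring. *)
Let spanned s (F : 'rV[K]_N -> K) : Prop :=
  exists a : 'I_d * {ffun T -> 'I_s} -> K, forall p, model p ->
    F p = \sum_x a x * monomial x.1 (fun k => x.2 k) p.

Let spanned_eq s F G : (forall p, model p -> F p = G p) -> spanned s F -> spanned s G.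
Proof. by move=> FG [a Ha]; exists a => p Yp; rewrite -FG ?Ha. Qed.

Let spanned_monomial s i e : (i < d)%N -> (forall k, (e k < s)%N) -> spanned s (monomial i e).
Proof.
move=> id es; pose x0 : 'I_d * {ffun T -> 'I_s} := (Ordinal id, [ffun k => Ordinal (es k)]).
exists (fun x => (x == x0)%:R) => p _; rewrite (bigD1 x0) //= eqxx mul1r.
rewrite big1 ?addr0 => [|x /negPf ->]; last by rewrite mul0r.
by congr (_ * _); apply: eq_bigr => k _; rewrite ffunE.
Qed.

Let spannedD s F G : spanned s F -> spanned s G -> spanned s (fun p => F p + G p).
Proof.
move=> [a Ha] [b Hb]; exists (fun x => a x + b x) => p Yp.
by rewrite Ha // Hb // -big_split; apply: eq_bigr => x _; rewrite mulrDl.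
Qed.

Let spannedZ s c F : spanned s F -> spanned s (fun p => c * F p).
Proof.
move=> [a Ha]; exists (fun x => c * a x) => p Yp.
by rewrite Ha // mulr_sumr; apply: eq_bigr => x _; rewrite mulrA.
Qed.

Let spanned_sum s (I : Type) (r : seq I) (F : I -> 'rV[K]_N -> K) :
  (forall i, spanned s (F i)) -> spanned s (fun p => \sum_(i <- r) F i p).
Proof.
move=> HF; elim: r => [|i r IH].
  by exists (fun=> 0) => p _; rewrite big_nil big1 // => x _; rewrite mul0r.
by apply: spanned_eq (spannedD (HF i) IH) => p _; rewrite big_cons.
Qed.

Let spanned_mul s s' F G : spanned s F ->
  (forall i e, (i < d)%N -> (forall k, (e k < s)%N) ->
     spanned s' (fun p => monomial i e p * G p)) ->
  spanned s' (fun p => F p * G p).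
Proof.
move=> [a Ha] HG.
have H x : spanned s' (fun p => a x * (monomial x.1 (fun k => x.2 k) p * G p)).
  by apply: spannedZ; apply: HG.
apply: spanned_eq (spanned_sum (index_enum _) H) => p Yp.
by rewrite Ha // mulr_suml; apply: eq_bigr => x _; rewrite mulrA.
Qed.

Let spanned_widen s s' F : (s <= s')%N -> spanned s F -> spanned s' F.
Proof.
move=> ss sF; apply: (@spanned_eq _ (fun p => F p * 1)).
  by move=> p _; rewrite mulr1.
apply: spanned_mul sF _ => i e id es.
apply: (@spanned_eq _ (monomial i e)); first by move=> p _; rewrite mulr1.
by apply: spanned_monomial => // k; exact: leq_trans (es k) ss.
Qed.

Let spanned_mul_free s k F : k \in S :\ z -> spanned s F ->
  spanned s.+1 (fun p => F p * p 0 k).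
Proof.
move=> kS sF; apply: spanned_mul sF _ => i e id es.
pose k0 : T := exist _ k kS.
apply: (@spanned_eq _ (monomial i (fun l => (l == k0) + e l)%N)).
  move=> p _; rewrite /monomial -mulrA; congr (_ * _).
  rewrite (eq_bigr (fun l : T => p 0 (val l) ^+ (l == k0) * p 0 (val l) ^+ e l)).
    rewrite big_split /= mulrC; congr (_ * _).
    rewrite (bigD1 k0) //= eqxx expr1 big1 ?mulr1 // => l /negPf ->.
    by rewrite expr0.
  by move=> l _; rewrite exprD.
by apply: spanned_monomial => // l; case: (l == k0); rewrite ?ltnS ?add0n //; exact: ltnW.
Qed.

(** Only the multiplication by [z] can leave the span, and the equation then
    trades [z ^+ d] for products of two other coordinates: hence [s.+2]. *)
Let spanned_mul_coord s k F : spanned s F -> spanned s.+2 (fun p => F p * p 0 k).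
Proof.
move=> sF; have [kS|kS] := boolP (k \in S); last first.
  apply: (@spanned_eq _ (fun p => base 0 k * F p)).
    by move=> p [pb _]; rewrite pb // mulrC.
  by apply/spannedZ/spanned_widen/sF/leqW.
have [->|kz] := eqVneq k z; last first.
  by apply/(spanned_widen (leqnSn _))/spanned_mul_free => //; rewrite !inE kz.
apply: spanned_mul sF _ => i e id es.
have [id'|di] := ltnP i.+1 d.
  apply: (@spanned_eq _ (monomial i.+1 e)); last first.
    by apply: spanned_monomial => // l; exact: leqW (leqW (es l)).
  by move=> p _; rewrite /monomial exprSr mulrAC.
have dE : d = i.+1 by apply/eqP; rewrite eqn_leq di.
apply: (@spanned_eq _ (fun p => \sum_j -1 * (monomial 0 e p * p 0 (al j) * p 0 (be j)))).
  move=> p [_ /eqP]; rewrite /quadric dE addr_eq0 => /eqP E.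
  rewrite /monomial expr0 mul1r mulrAC -exprSr E mulNr mulr_suml -sumrN.
  by apply: eq_bigr => j _; ring.
apply: spanned_sum => j; apply/spannedZ.
apply: spanned_mul_free; first by rewrite !inE eq_sym zbe beS.
apply: spanned_mul_free; first by rewrite !inE eq_sym zal alS.
by apply: spanned_monomial => //; exact: ltnW.
Qed.

Let spanned_evalp s (f : {mpoly K[N]}) :
  (msize f <= s.+1)%N -> spanned (2 * s).+1 (evalp f).
Proof.
move=> sf; apply: (@spanned_eq _
  (fun p => \sum_(m <- msupp f) f@_m * \prod_i p 0 i ^+ m i)).
  by move=> p _; rewrite /evalp mevalE.
rewrite /spanned; have [a Ha] : exists a : 'X_{1..N} -> 'I_d * {ffun T -> 'I_(2 * s).+1} -> K,
    forall m, m \in msupp f -> forall p, model p ->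
      \prod_i p 0 i ^+ m i = \sum_x a m x * monomial x.1 (fun k => x.2 k) p.
  have H m : exists a : 'I_d * {ffun T -> 'I_(2 * s).+1} -> K, m \in msupp f -> forall p, model p ->
      \prod_i p 0 i ^+ m i = \sum_x a x * monomial x.1 (fun k => x.2 k) p.
    have [mf|_] := boolP (m \in msupp f); last by exists (fun=> 0).
    suff [a Ha] : spanned (2 * s).+1 (fun p => \prod_i p 0 i ^+ m i) by exists a.
    have ms : (mdeg m <= s)%N by rewrite -ltnS (leq_trans _ sf) // msize_mdeg_lt.
    apply: (@spanned_widen (2 * mdeg m).+1); first by rewrite ltnS leq_mul2l ms orbT.
    rewrite mdegE; elim: (index_enum _) => [|i r IH].
      apply: (@spanned_eq _ (monomial 0 (fun=> 0%N))).
        by move=> p _; rewrite big_nil /monomial expr0 mul1r big1.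
      by apply: spanned_monomial => //; exact: ltnW.
    rewrite big_cons.
    apply: (@spanned_eq _ (fun p => p 0 i ^+ m i * \prod_(j <- r) p 0 j ^+ m j)).
      by move=> p _; rewrite big_cons.
    elim: (m i) => [|k IHk].
      by apply: spanned_eq IH => p _; rewrite expr0 mul1r.
    have -> : (2 * (k.+1 + \sum_(j <- r) m j)).+1 = ((2 * (k + \sum_(j <- r) m j)).+1).+2.
      by rewrite addSn mulnS.
    apply: spanned_eq (spanned_mul_coord i IHk) => p _.
    by rewrite exprS mulrC mulrA.
  by have [a Ha] := choice H; exists a.
exists (fun x => \sum_(m <- msupp f) f@_m * a m x) => p Yp.
under [RHS]eq_bigr => x _ do rewrite mulr_suml.
rewrite exchange_big /= !big_seq; apply: eq_bigr => m mf.
by rewrite Ha // mulr_sumr; apply: eq_bigr => x _; rewrite mulrA.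
Qed.

(** On the model, the polynomials of degree at most [s] lie in a space whose
    dimension grows like [s ^+ (#|S| - 1)], which cannot contain the independent
    families of [chain_growth] for a longer chain. *)
Lemma model_chain_bound p e c : chain_at model p e c -> (e <= #|S :\ z|)%N.
Proof.
move=> ch; rewrite leqNgt; apply/negP => De.
have [C HC] := chain_growth ch.
have [t ht] := @exp_outgrows d (2 * C) _ _ De.
have [I [G [cI sG freeG]]] := HC t.
have [A HA] := fin_all_exists (fun i => spanned_evalp (sG i)).
have [|r [i0 ri0] Hr] := linear_relation A.
  rewrite card_prod card_ord card_ffun card_ord cI card_sig.
  by rewrite -mulnA in ht; rewrite (eq_card (B := S :\ z)).
move: ri0; rewrite (freeG r) ?eqxx // => q /(chain_subset ch (leqnn e)) Yq.
under eq_bigr => i _ do rewrite HA // mulr_sumr.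
rewrite exchange_big big1 // => x _ /=.
under eq_bigr => i _ do rewrite mulrA.
by rewrite -mulr_suml Hr mul0r.
Qed.

End Model.

(** * Tangent spaces *)

Section TangentSpaces.
Variables (K : numFieldType) (N : nat).
Implicit Types (X : set 'rV[K]_N) (p v : 'rV[K]_N).

Lemma tangentD X p v w :
  tangent_space X p v -> tangent_space X p w -> tangent_space X p (v + w).
Proof.
move=> Tv Tw f If; under eq_bigr => k _ do rewrite mxE mulrDr.
by rewrite big_split /= Tv // Tw // addr0.
Qed.

Lemma tangentZ X p a v : tangent_space X p v -> tangent_space X p (a *: v).
Proof.
move=> Tv f If; under eq_bigr => k _ do rewrite mxE mulrCA.
by rewrite -mulr_sumr Tv // mulr0.
Qed.

Lemma tangent_sum X p (I : Type) (r : seq I) (P : pred I) (w : I -> 'rV[K]_N) :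
  (forall i, P i -> tangent_space X p (w i)) ->
  tangent_space X p (\sum_(i <- r | P i) w i).
Proof.
move=> Tw; apply: big_ind => //; last by move=> *; exact: tangentD.
by move=> f _; apply: big1 => k _; rewrite mxE mulr0.
Qed.

(** A tangent vector kills the derivative at [p] of any polynomial function of
    [X], and that derivative can be read on the line through [p] directed by
    [v]; the partial derivatives need not be computed. *)
Lemma tangent_line X p v f (P : {poly K}) :
  tangent_space X p v -> vanishing_ideal X f ->
  (forall t, evalp f (p + t *: v) = P.[t]) -> P^`().[0] = 0.
Proof.
move=> Tv If fP; pose gam k := (p 0 k)%:P + (v 0 k)%:P * 'X.
have gE t : curve_at gam t = p + t *: v.
  by apply/rowP => k; rewrite !mxE !hornerE mulrC.
have -> : P = mmap (@polyC K) gam f.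
  apply/eqP; rewrite -subr_eq0; apply/eqP.
  apply: (@poly_eq0_on_cofinite K _ 1); first exact: oner_neq0.
  by move=> t _; rewrite hornerD hornerN evalp_curve gE fP subrr.
rewrite (derivation_mmap _ (@derivD K) (@derivM K) (@derivC K)) horner_sum.
rewrite -[RHS](Tv f If); apply: eq_bigr => k _.
rewrite hornerM evalp_curve gE scale0r addr0; congr (_ * _).
by rewrite derivD derivM !derivC derivX !hornerE.
Qed.

(** Vectors dual to the coordinates in [A] span a space of dimension [#|A|], which
    consists of the vectors that are recovered from these coordinates. *)
Lemma coordinate_space (A : {set 'I_N}) (w : 'I_N -> 'rV[K]_N) :
  (forall k l, k \in A -> l \in A -> w k 0 l = (l == k)%:R) ->
  exists T : {vspace 'rV[K]_N}, \dim T = #|A| /\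
    forall v, v \in T <-> v = \sum_(k in A) v 0 k *: w k.
Proof.
move=> wA; pose M : 'M[K]_(#|A|, N) := \matrix_(i, l) w (enum_val i) 0 l.
pose D : 'Hom('rV[K]_#|A|, 'rV[K]_N) := linfun (mulmxr M).
have DE u : D u = \sum_i u 0 i *: w (enum_val i).
  rewrite lfunE /=; apply/rowP => l; rewrite mxE summxE.
  by apply: eq_bigr => i _; rewrite !mxE.
have Dcoord u i : D u 0 (enum_val i) = u 0 i.
  rewrite DE summxE (bigD1 i) //= mxE wA ?enum_valP // eqxx mulr1 big1 ?addr0 // => j ji.
  rewrite mxE wA ?enum_valP // (negPf (_ : enum_val i != enum_val j)) ?mulr0 //.
  by apply: contra ji => /eqP/enum_val_inj ->.
have vE v : \sum_(k in A) v 0 k *: w k = D (\row_i v 0 (enum_val i)).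
  by rewrite big_enum_val DE; apply: eq_bigr => i _; rewrite mxE.
exists (limg D); split.
  rewrite limg_dim_eq; first by rewrite dimvf dim_matrix mul1r.
  apply/eqP; rewrite -subv0; apply/subvP => u.
  rewrite memv_cap memv_ker => /andP[_ /eqP u0]; rewrite memv0; apply/eqP/rowP => i.
  by rewrite -Dcoord u0 !mxE.
move=> v; rewrite vE; split => [/memv_imgP[u _ ->]|->]; last exact: memv_img (memvf _).
by congr (D _); apply/rowP => i; rewrite mxE Dcoord.
Qed.

End TangentSpaces.

(** * Regular and singular points of the model *)

Section ModelPoints.
Variables (K : numFieldType) (N d : nat) (J : finType).
Variables (S : {set 'I_N}) (base : 'rV[K]_N) (z : 'I_N) (al be : J -> 'I_N).
Hypotheses (zS : z \in S) (alS : forall j, al j \in S) (beS : forall j, be j \in S).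
Hypotheses (al_inj : injective al) (be_inj : injective be).
Hypotheses (zal : forall j, z != al j) (zbe : forall j, z != be j).
Hypothesis albe : forall i j, al i != be j.
Hypothesis d_gt1 : (1 < d)%N.
Implicit Types (p q v : 'rV[K]_N) (c : 'I_N -> {poly K}).

Local Notation X := (model d S base z al be).
Local Notation quad := (quadric d z al be).

Lemma tangent_off p v : X p -> tangent_space X p v -> forall k, k \notin S -> v 0 k = 0.
Proof.
move=> [pb _] Tv k kS.
have If : vanishing_ideal X ('X_k - (base 0 k)%:MP).
  by move=> q [qb _]; rewrite evalpB evalpX evalpC qb // subrr.
have /(tangent_line Tv If) : forall t,
    evalp ('X_k - (base 0 k)%:MP) (p + t *: v) = ((v 0 k)%:P * 'X).[t].
  move=> t; rewrite evalpB evalpX evalpC !mxE pb // hornerM hornerC hornerX.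
  by ring.
by rewrite derivM derivC derivX !hornerE.
Qed.

Section NonzeroAlpha.
Variable j0 : J.
Local Notation a := (al j0).
Local Notation b := (be j0).

Definition weighted k := (k == z) || [exists j, (j != j0) && (k == al j)].

(** Where the coordinate [a] is nonzero the equation can be solved for [b], but
    only rationally.  Writing [z] and the other [al j] as multiples of [a]
    clears the denominator: every assignment [c] of polynomials in [t] to the
    coordinates other than [b] yields a polynomial curve on the model. *)
Definition solve_curve c k : {poly K} :=
  if k \notin S then (base 0 k)%:P else
  if k == b then
    - (c a ^+ d.-1 * c z ^+ d + \sum_(j | j != j0) c (al j) * c (be j))
  else if weighted k then c a * c k else c k.

Definition chart_coord q k : K := if weighted k then q 0 k / q 0 a else q 0 k.

Lemma aNb : (a == b) = false. Proof. exact/negbTE/albe. Qed.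

Lemma a_unweighted : weighted a = false.
Proof.
rewrite /weighted eq_sym (negbTE (zal j0)) /=; apply/existsP => -[j /andP[jj0 /eqP]].
by move=> /al_inj E; rewrite E eqxx in jj0.
Qed.

Lemma be_unweighted j : weighted (be j) = false.
Proof.
rewrite /weighted eq_sym (negbTE (zbe j)) /=; apply/existsP => -[i /andP[_ /eqP E]].
by have := albe i j; rewrite E eqxx.
Qed.

Lemma al_weighted j : j != j0 -> weighted (al j).
Proof. by move=> jj0; apply/orP; right; apply/existsP; exists j; rewrite jj0 eqxx. Qed.

Lemma solve_curve_coord c t k : k \in S :\ b ->
  curve_at (solve_curve c) t 0 k =
  (if weighted k then (c a).[t] else 1) * (c k).[t].
Proof.
rewrite !inE => /andP[kb kS]; rewrite mxE /solve_curve kS (negbTE kb) /=.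
by case: ifP => _; rewrite ?hornerM ?mul1r.
Qed.

Lemma solve_curve_model c t : X (curve_at (solve_curve c) t).
Proof.
split=> [k kS|]; first by rewrite mxE /solve_curve kS hornerC.
rewrite /quadric (bigD1 j0) //=.
rewrite (eq_bigr (fun j => (c a).[t] * ((c (al j)).[t] * (c (be j)).[t]))) => [|j jj0].
  have [zSb aSb] : z \in S :\ b /\ a \in S :\ b by rewrite !inE zbe aNb zS alS.
  rewrite -mulr_sumr (solve_curve_coord _ _ zSb) (solve_curve_coord _ _ aSb).
  rewrite a_unweighted /weighted eqxx mxE /solve_curve beS eqxx /=.
  rewrite hornerN hornerD hornerM !horner_exp horner_sum.
  under [X in _ * - (_ + X)]eq_bigr => j _ do rewrite hornerM.
  by rewrite exprMn -[in X in X * _](prednK (ltnW d_gt1)) exprS; ring.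
rewrite !solve_curve_coord ?inE ?albe ?alS ?(inj_eq be_inj) ?jj0 ?beS //.
by rewrite al_weighted // be_unweighted mul1r mulrA.
Qed.

Lemma model_ext p q : X p -> X q -> p 0 a != 0 ->
  (forall k, k \in S :\ b -> p 0 k = q 0 k) -> p = q.
Proof.
move=> [pb pq] [qb qq] pa E.
have Eb k : k != b -> p 0 k = q 0 k.
  move=> kb; have [kS|kS] := boolP (k \in S); last by rewrite pb // qb.
  by apply: E; rewrite !inE kb.
apply/rowP => k; have [->|] := eqVneq k b; last exact: Eb.
apply: (mulfI pa); rewrite {2}(Eb a) ?aNb //.
move: pq; rewrite -qq /quadric (Eb z) ?zbe // => /addrI.
rewrite !(bigD1 (P := predT) j0) //= [X in _ + X = _](eq_bigr (fun j => q 0 (al j) * q 0 (be j))).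
  by move/addIr.
by move=> j jj0; rewrite (Eb (al j)) ?(Eb (be j)) ?(inj_eq be_inj) ?albe.
Qed.

Lemma solve_curve_point c t q : X q -> q 0 a != 0 ->
  (forall k, k \in S :\ b -> (c k).[t] = chart_coord q k) ->
  curve_at (solve_curve c) t = q.
Proof.
move=> Xq qa ct; apply/esym/model_ext => // [|k kS]; first exact: solve_curve_model.
rewrite solve_curve_coord // !ct //; last by rewrite !inE aNb alS.
rewrite /chart_coord a_unweighted; case: (weighted k); last by rewrite mul1r.
by rewrite mulrCA divff // mulr1.
Qed.

Definition slice p (F : {set 'I_N}) : set 'rV[K]_N :=
  [set q : 'rV[K]_N | [/\ X q, q 0 a != 0 & forall k, k \in F -> q 0 k = p 0 k]].

(** The coordinate [a] has to be among the fixed ones, unless none is fixed,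
    since the curve joining two points multiplies the weighted coordinates by
    [a]. *)
Lemma slice_irreducible p (F : {set 'I_N}) : X p -> p 0 a != 0 ->
  F \subset S :\ b -> a \in F \/ F = finset.set0 ->
  zariski_irreducible (zariski_closure (slice p F)).
Proof.
move=> Xp pa FS aF; apply: closure_irreducible; first by exists p.
move=> q r [Xq qa qF] [Xr ra rF].
pose c k := (chart_coord q k)%:P + (chart_coord r k - chart_coord q k)%:P * 'X.
have aS : a \in S :\ b by rewrite !inE aNb alS.
exists (solve_curve c), (c a); split.
- by apply: solve_curve_point => // k _; rewrite !hornerE.
- by apply: solve_curve_point => // k _; rewrite hornerD hornerM !hornerC hornerX mulr1 addrC subrK.
- apply/negP => /eqP/(congr1 (horner^~ 0)); rewrite !hornerE => /eqP.
  by rewrite /chart_coord a_unweighted (negbTE qa).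
move=> t cat; split; first exact: solve_curve_model.
  by rewrite solve_curve_coord // a_unweighted mul1r.
move=> k kF; case: aF => [aF|F0]; last by rewrite F0 inE in kF.
have kS := fintype.subsetP FS k kF; rewrite solve_curve_coord //.
rewrite !hornerE /chart_coord a_unweighted (qF a aF) (rF a aF) (qF k kF) (rF k kF).
rewrite !subrr !mul0r !addr0; case: (weighted k); last by rewrite mul1r.
by rewrite mulrCA divff // mulr1.
Qed.

(** Adding [p 0 a] to the coordinate [x] keeps [a] nonzero even if [x = a]. *)
Lemma slice_move p (F : {set 'I_N}) x : X p -> p 0 a != 0 ->
  F \subset S :\ b -> a \in F \/ F = finset.set0 -> x \in S :\ b -> x \notin F ->
  exists2 q, slice p F q & q 0 x != p 0 x.
Proof.
move=> Xp pa FS aF xS xF.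
have aS : a \in S :\ b by rewrite !inE aNb alS.
pose c k := (chart_coord p k + (k == x)%:R * p 0 a)%:P.
have ca : (c a).[0] != 0.
  rewrite hornerC /chart_coord a_unweighted.
  by rewrite mulr_natl -mulrS mulrn_eq0 negb_or pa.
exists (curve_at (solve_curve c) 0).
  split; first exact: solve_curve_model.
    by rewrite solve_curve_coord // a_unweighted mul1r.
  move=> k kF; case: aF => [aF|F0]; last by rewrite F0 inE in kF.
  have kS := fintype.subsetP FS k kF; rewrite solve_curve_coord // !hornerC.
  have -> : (a == x) = false by apply: contraNF xF => /eqP <-.
  have -> : (k == x) = false by apply: contraNF xF => /eqP <-.
  rewrite !mul0r !addr0 /chart_coord a_unweighted.
  case: (weighted k); rewrite ?mul1r //.
  by rewrite mulrCA divff // mulr1.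
rewrite solve_curve_coord // !hornerC eqxx mul1r /chart_coord a_unweighted.
case: ifP => wx; last first.
  by rewrite mul1r -subr_eq0 addrC addKr.
have -> : (a == x) = false.
  by apply/negP => /eqP ax; rewrite -ax a_unweighted in wx.
rewrite mul0r addr0 mulrDr mulrCA divff // mulr1.
by rewrite -subr_eq0 addrC addKr mulf_neq0.
Qed.

(** Free the coordinates other than [b] one at a time, [a] being the last: the
    closures of the slices form a chain of full length. *)
Lemma model_chain p : X p -> p 0 a != 0 -> exists C, chain_at X p #|S :\ b| C.
Proof.
move=> Xp pa; have aS : a \in S :\ b by rewrite !inE aNb alS.
pose s := rcons (enum (S :\ b :\ a)) a.
have us : uniq s by rewrite rcons_uniq enum_uniq mem_enum !inE eqxx.
have ms k : (k \in s) = (k \in S :\ b).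
  rewrite mem_rcons inE mem_enum in_setD1; case: (eqVneq k a) => [->|//].
  by rewrite aS.
have ss : size s = #|S :\ b|.
  by rewrite size_rcons -cardE (cardsD1 a (S :\ b)) aS.
pose F i : {set 'I_N} := [set k in drop i s].
have FS i : F i \subset S :\ b.
  by apply/fintype.subsetP => k; rewrite inE => /mem_drop; rewrite ms.
have aF i : a \in F i \/ F i = finset.set0.
  rewrite /F /s; have [si|] := leqP i (size (enum (S :\ b :\ a))).
    by left; rewrite inE drop_rcons // mem_rcons inE eqxx.
  by move=> si; right; apply/setP => k; rewrite !inE drop_oversize // size_rcons.
exists (fun i => zariski_closure (slice p (F i))); split => i iD.
  split.
  - exact: closure_closed.
  - exact: slice_irreducible.
  - by apply: closure_min; [exact: model_closed|move=> q []].
  - exact: sub_closure.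
rewrite -ss in iD; set x := nth a s i.
have xF : x \in F i by rewrite inE (drop_nth a iD) mem_head.
have FxF k : k \in F i.+1 -> k \in F i.
  by rewrite !inE (drop_nth a iD) in_cons => ->; rewrite orbT.
have xF' : x \notin F i.+1.
  have := drop_uniq i us; rewrite (drop_nth a iD) /= => /andP[xd _].
  by rewrite inE.
split.
  apply: closure_min; first exact: closure_closed.
  move=> q [Xq qa qF]; apply: sub_closure; split => // k /FxF; exact: qF.
have [q Wq qx] := slice_move Xp pa (FS i.+1) (aF i.+1) (fintype.subsetP (FS i) x xF) xF'.
move=> sub; have := sub q (sub_closure Wq) ('X_x - (p 0 x)%:MP).
rewrite evalpB evalpX evalpC => /(_ _)/eqP; rewrite subr_eq0 (negbTE qx) => /(_ _)/negP[] // r [_ _ rF].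
by rewrite evalpB evalpX evalpC rF // subrr.
Qed.

(** The derivative of the equation with respect to [b] is the value of [a]. *)
Lemma tangent_determined p v : X p -> p 0 a != 0 -> tangent_space X p v ->
  (forall k, k \in S :\ b -> v 0 k = 0) -> v = 0.
Proof.
move=> Xp pa Tv v0; have vb k : k != b -> v 0 k = 0.
  move=> kb; have [kS|kS] := boolP (k \in S); last exact: (tangent_off Xp Tv).
  by apply: v0; rewrite !inE kb.
apply/rowP => k; rewrite [RHS]mxE; have [->|] := eqVneq k b; last exact: vb.
have [f Hf] := quadric_polynomial K d z al be.
have If : vanishing_ideal X f by move=> q [_]; rewrite Hf.
have /(tangent_line Tv If) : forall t, evalp f (p + t *: v) = ((p 0 a * v 0 b)%:P * 'X).[t].
  move=> t; rewrite -Hf -[LHS]subr0 -[X in _ - X]Xp.2 /quadric.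
  have qE l : l != b -> (p + t *: v) 0 l = p 0 l.
    by move=> lb; rewrite !mxE vb // mulr0 addr0.
  rewrite qE ?zbe // opprD addrACA subrr add0r !(bigD1 (P := predT) j0) //=.
  rewrite [X in _ + X - _](eq_bigr (fun j => p 0 (al j) * p 0 (be j))) => [|j jj0]; last first.
    by rewrite !qE ?(inj_eq be_inj) ?albe.
  by rewrite opprD addrACA subrr addr0 qE ?albe // !mxE !hornerE; ring.
rewrite derivM derivC derivX !hornerE => /eqP.
by rewrite mulf_eq0 (negbTE pa) => /eqP.
Qed.

(** The slopes [s] are chosen so that the products [c a * c k] have the prescribed
    derivatives at [0]. *)
Lemma tangent_realize p (u : 'I_N -> K) : X p -> p 0 a != 0 ->
  exists v, tangent_space X p v /\ forall k, k \in S :\ b -> v 0 k = u k.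
Proof.
move=> Xp pa; have aS : a \in S :\ b by rewrite !inE aNb alS.
pose s k := if weighted k then (u k - u a * (p 0 k / p 0 a)) / p 0 a else u k.
pose c k := (chart_coord p k)%:P + (s k)%:P * 'X.
have c0 k : (c k).[0] = chart_coord p k by rewrite /c !hornerE.
have c'0 k : ((c k)^`()).[0] = s k.
  by rewrite /c derivD derivM !derivC derivX !hornerE.
exists (\row_k ((solve_curve c k)^`()).[0]); split.
  have <- : curve_at (solve_curve c) 0 = p by apply: solve_curve_point.
  by apply: curve_tangent => t; exact: solve_curve_model.
move=> k; rewrite !inE => /andP[kb kS].
rewrite mxE /solve_curve kS (negbTE kb) /=; case: ifP => wk; last first.
  by rewrite c'0 /s wk.
rewrite derivM hornerD !hornerM !c'0 !c0 /s /chart_coord a_unweighted wk.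
by rewrite [p 0 a * _]mulrC divfK // addrC subrK.
Qed.

(** The coordinates in [S :\ b] are free and determining on the tangent space
    ([tangent_realize], [tangent_determined]), so its dimension is the length of
    the chain of slices. *)
Lemma model_regular p : X p -> p 0 a != 0 -> regular_point X p.
Proof.
move=> Xp pa; have cS : #|S :\ b| = #|S :\ z|.
  by have := cardsD1 z S; rewrite (cardsD1 b S) zS beS => -[].
have [w Hw] := choice (fun k => tangent_realize (fun l => (l == k)%:R) Xp pa).
have [|T [dT memT]] := @coordinate_space K N (S :\ b) w.
  by move=> k l _ lS; rewrite (Hw k).2.
exists #|S :\ b|, T; split => //.
  split; first exact: model_chain.
  by move=> e c; rewrite cS; exact: model_chain_bound.
apply/seteqP; split => v /=.
  by move=> /memT ->; apply: tangent_sum => k _; apply/tangentZ/(Hw k).1.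
move=> Tv; apply/memT/eqP; rewrite -subr_eq0; apply/eqP.
apply: (tangent_determined Xp pa) => [|l lS].
  apply: tangentD => //; rewrite -scaleN1r; apply: tangentZ.
  by apply: tangent_sum => k _; apply/tangentZ/(Hw k).1.
rewrite mxE [X in _ + X]mxE summxE (bigD1 l) //= mxE (Hw l).2 // eqxx mulr1.
rewrite big1 ?addr0 ?subrr // => k /andP[_ kl].
by rewrite mxE (Hw k).2 // eq_sym (negbTE kl) mulr0.
Qed.


End NonzeroAlpha.
(** At a point where all the [al j] and [be j] vanish the equation has no linear
    term, so the coordinate lines other than that of [z] stay on the model, and
    the curve [z = t], [al j0 = - t], [be j0 = t ^ (d - 1)] supplies the last
    direction: the tangent space is larger than any chain allows. *)
Lemma model_singular (j0 : J) p : X p ->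
  (forall j, p 0 (al j) = 0 /\ p 0 (be j) = 0) -> ~ regular_point X p.
Proof.
move=> Xp p0 [e [T [[[c chc] _] TT dT]]].
have pz : p 0 z = 0.
  have := Xp.2; rewrite /quadric big1 ?addr0 => [/eqP|j _]; last by rewrite (p0 j).1 mul0r.
  by rewrite expf_eq0 => /andP[_ /eqP].
have T_line k : k \in S -> k != z -> tangent_space X p (delta_mx 0 k).
  move=> kS kz; pose gam l := (p 0 l)%:P + (l == k)%:R *: 'X.
  have gE t l : curve_at gam t 0 l = p 0 l + (l == k)%:R * t by rewrite mxE !hornerE.
  have gp : curve_at gam 0 = p by apply/rowP => l; rewrite gE mulr0 addr0.
  have -> : delta_mx 0 k = \row_l ((gam l)^`()).[0].
    apply/rowP => l; rewrite !mxE eqxx derivD derivC derivZ derivX !hornerE.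
    by rewrite /= eq_sym.
  rewrite -{1}gp; apply: curve_tangent => t; split.
    move=> l lS; rewrite gE (Xp.1 l lS) (negbTE (_ : l != k)) ?mul0r ?addr0 //.
    by apply: contraNneq lS => ->.
  rewrite /quadric gE pz eq_sym (negbTE kz) mul0r addr0 expr0n eqn0Ngt ltnW //.
  rewrite add0r big1 // => j _; rewrite !gE (p0 j).1 (p0 j).2 !add0r.
  have [<-|_] := eqVneq (al j) k; last by rewrite !mul0r.
  by rewrite [be j == _]eq_sym (negbTE (albe j j)) !mul0r mulr0.
have T_z : tangent_space X p (delta_mx 0 z).
  pose gam l := if l == z then 'X else if l == al j0 then - 'X else
    if l == be j0 then 'X ^+ d.-1 else (p 0 l)%:P.
  have gz : gam z = 'X by rewrite /gam eqxx.
  have ga : gam (al j0) = - 'X by rewrite /gam eq_sym (negbTE (zal _)) eqxx.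
  have gb : gam (be j0) = 'X ^+ d.-1.
    by rewrite /gam eq_sym (negbTE (zbe _)) eq_sym (negbTE (albe _ _)) eqxx.
  have goff l : l != z -> l != al j0 -> l != be j0 -> gam l = (p 0 l)%:P.
    by rewrite /gam => /negbTE -> /negbTE -> /negbTE ->.
  have gp : curve_at gam 0 = p.
    apply/rowP => l; rewrite mxE /gam; have [->|_] := eqVneq l z.
      by rewrite hornerX pz.
    have [->|_] := eqVneq l (al j0); first by rewrite hornerN hornerX oppr0 (p0 j0).1.
    have [->|_] := eqVneq l (be j0); last by rewrite hornerC.
    rewrite horner_exp hornerX (p0 j0).2 expr0n.
    by case: (d) d_gt1 => [|[]].
  have gX t : X (curve_at gam t).
    split=> [l lS|].
      by rewrite mxE goff ?hornerC ?Xp.1 //; apply: contraNneq lS => ->.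
    rewrite /quadric (bigD1 j0) //= !mxE gz ga gb hornerN horner_exp !hornerX.
    rewrite big1 ?addr0 => [|j jj0].
      by rewrite mulNr -exprS prednK ?subrr // ltnW.
    have jz : al j != z by rewrite eq_sym.
    rewrite !mxE goff ?(inj_eq al_inj) ?albe //.
    by rewrite hornerC (p0 j).1 mul0r.
  have Tw := curve_tangent gX; rewrite gp in Tw; set w := \row_l _ in Tw.
  have woff l : l \notin S -> w 0 l = 0.
    by move=> lS; rewrite mxE goff ?derivC ?hornerC //; apply: contraNneq lS => ->.
  have scE (x : K) k l : (x *: delta_mx 0 k : 'rV_N) 0 l = x * (l == k)%:R.
    by rewrite !mxE eqxx.
  have -> : delta_mx 0 z = w - \sum_(k in S :\ z) w 0 k *: delta_mx 0 k.
    apply/rowP => l; rewrite [LHS]mxE [RHS]mxE [X in _ + X]mxE summxE.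
    under eq_bigr => k _ do rewrite scE.
    have [->|lz] := eqVneq l z.
      rewrite eqxx mxE gz derivX hornerC big1 ?subr0 // => k; rewrite !inE => /andP[kz _].
      by rewrite eq_sym (negbTE kz) mulr0.
    rewrite eqxx /=; have [lS|lS] := boolP (l \in S); last first.
      rewrite woff // big1 ?subr0 // => k; rewrite !inE => /andP[_ kS].
      by rewrite (negbTE (_ : l != k)) ?mulr0 //; apply: contraNneq lS => ->.
    rewrite (bigD1 l) ?inE ?lz //= eqxx mulr1 big1 ?addr0 ?subrr // => k /andP[_ kl].
    by rewrite eq_sym (negbTE kl) mulr0.
  apply: tangentD => //; rewrite -scaleN1r; apply: tangentZ; apply: tangent_sum => k.
  by rewrite !inE => /andP[kz kS]; apply/tangentZ/T_line.
have TS k : k \in S -> delta_mx 0 k \in T.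
  move=> kS; suff : [set` T] (delta_mx 0 k) by [].
  by rewrite TT; have [->|kz] := eqVneq k z; [exact: T_z|exact: T_line].
have [|U [dU memU]] := @coordinate_space K N S (fun k => delta_mx 0 k).
  by move=> k l _ _; rewrite mxE eqxx.
have : (#|S| <= e)%N.
  rewrite -dU -dT; apply/dimvS/subvP => v /memU ->.
  by apply: memv_suml => k kS; apply/memvZ/TS.
rewrite (cardsD1 z S) zS add1n ltnNge => /negP; apply.
exact: model_chain_bound chc.
Qed.

End ModelPoints.

Lemma model_swap (K : numFieldType) (N d : nat) (J : finType) (S : {set 'I_N})
    (base : 'rV[K]_N) z (al be : J -> 'I_N) :
  model d S base z al be = model d S base z be al.
Proof.
apply/seteqP; split => p [pb pq]; split => //; rewrite -pq;
  by congr (_ + _); apply: eq_bigr => j _; rewrite mulrC.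
Qed.

Lemma model_singular_locus (K : numFieldType) (N d : nat) (J : finType) (j0 : J)
    (S : {set 'I_N}) (base : 'rV[K]_N) z (al be : J -> 'I_N) :
  z \in S -> (forall j, al j \in S) -> (forall j, be j \in S) ->
  injective al -> injective be ->
  (forall j, z != al j) -> (forall j, z != be j) -> (forall i j, al i != be j) ->
  (1 < d)%N ->
  singular_locus (model d S base z al be) =
  [set p | model d S base z al be p /\ forall j, p 0 (al j) = 0 /\ p 0 (be j) = 0].
Proof.
move=> zS alS beS al_inj be_inj zal zbe albe d1.
apply/seteqP; split => p [Xp Hp]; split => //; last exact: model_singular.
move=> j; split; apply/eqP; apply: contrapT => /negP pj; apply: Hp.
  by apply: (@model_regular _ _ _ _ _ _ _ _ _ zS alS beS _ _ _ _ _ _ j).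
rewrite model_swap in Xp *.
by apply: (@model_regular _ _ _ _ _ _ _ _ _ zS beS alS _ _ _ _ _ _ j) => // i k; rewrite eq_sym.
Qed.

(** * Straightening coordinates on the Hessenberg chart *)

Section Coordinates.
Variables (K : fieldType) (n' m : nat).
Local Notation n := n'.+1.
Hypotheses (m_gt1 : (1 < m)%N) (m_le : (m <= n')%N).
Implicit Types (g y : 'M[K]_n) (c : 'cV[K]_n).

Local Notation J := 'I_m.-1.
Local Notation Nil := (regular_nilpotent K n).

Definition colJ (j : J) : 'I_n := inord j.+1.
Definition rowJ (j : J) : 'I_n := inord j.+2.

Lemma colJE j : colJ j = j.+1 :> nat.
Proof. by rewrite inordK //; have := ltn_ord j; lia. Qed.

Lemma rowJE j : rowJ j = j.+2 :> nat.
Proof. by rewrite inordK //; have := ltn_ord j; lia. Qed.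

(** The coordinates of [N v_1] in the basis of the columns of [g]; the adjugate
    makes them polynomial in [g]. *)
Definition shift_coefs g : 'cV[K]_n := \adj g *m (Nil *m col ord0 g).

(** The contribution of column [j] to the solution at step [i] of the recurrence
    [a_(l+1) = x * a_l + y_(l,j)] started from [0]. *)
Definition horner_sum_col y (x : K) (i : nat) (j : 'I_n) : K :=
  \sum_(l < i) x ^+ (i - l.+1) * y (inord l) j.

Definition shift_entry g (i : nat) : K := if (i < n)%N then g (inord i) ord0 else 0.

Lemma lower_unipotent_det g : lower_unipotent g -> \det g = 1.
Proof.
move=> [g1 g0]; rewrite det_trig; last by apply/is_trig_mxP => i j; exact: g0.
by rewrite big1.
Qed.

Lemma shift_coefsK g : lower_unipotent g -> g *m shift_coefs g = Nil *m col ord0 g.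
Proof. by move=> lg; rewrite mulmxA mul_mx_adj lower_unipotent_det ?mul1mx. Qed.

Lemma shift_coefs_unique g c : lower_unipotent g ->
  g *m c = Nil *m col ord0 g -> c = shift_coefs g.
Proof.
by move=> lg E; rewrite /shift_coefs -E mulmxA mul_adj_mx lower_unipotent_det ?mul1mx.
Qed.

Lemma nilpotent_colE g i : (Nil *m col ord0 g) i 0 = shift_entry g i.+1.
Proof.
rewrite mxE /shift_entry; case: ifP => [iN|/negbT iN].
  rewrite (bigD1 (inord i.+1)) //= !mxE inordK // eqxx mul1r big1 ?addr0 // => k ki.
  rewrite !mxE (_ : (_ == _) = false) ?mul0r //; apply: contraNF ki => /eqP ik.
  by apply/eqP/val_inj; rewrite /= inordK.
rewrite big1 // => k _; rewrite !mxE (_ : (_ == _) = false) ?mul0r //.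
by apply: contraNF iN => /eqP ->.
Qed.

Lemma chart_shift_coefs g : lower_unipotent g ->
  Hess_chart Nil (hess_fun n m) g <->
  forall k : 'I_n, (m <= k)%N -> shift_coefs g k 0 = 0.
Proof.
move=> lg; have dg := lower_unipotent_det lg.
have ug : g \in unitmx by rewrite unitmxE dg unitr1.
rewrite Hess_chartE //; first last.
- by move=> i /andP[i1 iN]; rewrite /hess_fun; case: eqP => [->|_]; lia.
- by move=> i j ij jN; rewrite /hess_fun; do 2 case: eqP => ?; lia.
have E (k : 'I_n) : shift_coefs g k 0 = (invmx g *m Nil *m g) k ord0.
  by rewrite /shift_coefs /invmx ug dg invr1 scale1r -col_mulmx -mulmxA -col_mulmx mxE.
split=> [H k mk|H i j]; first by rewrite E; apply: H.
rewrite /hess_fun; case: eqP => [[j0]|_]; last by have := ltn_ord i; lia.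
by move=> mi; rewrite -[RHS](H i mi) E; congr (_ _ _); apply: val_inj.
Qed.

Lemma sum_head (F : 'I_n -> K) : (forall k : 'I_n, (m <= k)%N -> F k = 0) ->
  \sum_k F k = F ord0 + \sum_(j : J) F (colJ j).
Proof.
move=> F0; rewrite big_ord_recl; congr (_ + _).
rewrite (big_ord_widen n' (fun j => F (inord j.+1))); last by lia.
rewrite [RHS]big_mkcond; apply: eq_bigr => j _.
have -> : inord j.+1 = lift ord0 j by apply: val_inj; rewrite /= inordK // ltnS.
by case: ifP => // jm; apply: F0; rewrite /= /bump /=; lia.
Qed.

Lemma horner_sum_colS y x i j :
  horner_sum_col y x i.+1 j = x * horner_sum_col y x i j + y (inord i) j.
Proof.
rewrite /horner_sum_col big_ord_recr /= subnn expr0 mul1r mulr_sumr; congr (_ + _).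
by apply: eq_bigr => l _; rewrite mulrA -exprS; congr (_ ^+ _ * _); have := ltn_ord l; lia.
Qed.

Lemma eq_horner_sum_col y y' x i j : (forall l, (l < i)%N -> y (inord l) j = y' (inord l) j) ->
  horner_sum_col y x i j = horner_sum_col y' x i j.
Proof. by move=> E; apply: eq_bigr => l _; rewrite E. Qed.

(** The relation [N v_1 = \sum_k c_k v_k], read row by row, is a first order
    recurrence for the first column of [g], solved by Horner sums.  Its last row,
    where the shifted entry is [0], is the equation of the chart. *)
Lemma shift_entry_closed g i : Hess_chart Nil (hess_fun n m) g -> (i <= n)%N ->
  let c := shift_coefs g in
  shift_entry g i = c ord0 0 ^+ i +
    \sum_j c (colJ j) 0 * horner_sum_col g (c ord0 0) i (colJ j).
Proof.
move=> Hg iN c; have lg := Hg.1.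
have c0 := (chart_shift_coefs lg).1 Hg.
elim: i iN => [_|i IH iN].
  rewrite expr0 big1 ?addr0; last by move=> j _; rewrite /horner_sum_col big_ord0 mulr0.
  rewrite /shift_entry /= (_ : inord 0 = ord0); first exact: lg.1.
  by apply: val_inj; rewrite /= inordK.
have Ei := nilpotent_colE g (inord i); rewrite inordK // in Ei.
rewrite -Ei -shift_coefsK // mxE sum_head; last by move=> k mk; rewrite c0 // mulr0.
have -> : g (inord i) ord0 = shift_entry g i by rewrite /shift_entry iN.
rewrite (IH (ltnW iN)) -/c exprS.
under [in RHS]eq_bigr => j _ do rewrite horner_sum_colS mulrDr mulrCA.
rewrite big_split /= -mulr_sumr addrA -mulrDr mulrC; congr (_ + _).
by apply: eq_bigr => j _; rewrite mulrC.
Qed.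

(** The first column keeps the [c_k], moved one row down, and the last entry of
    column [j] is replaced by the coefficient of [c_j] in the equation of the
    chart, which makes that equation bilinear up to the power of [c_0]. *)
Definition straighten g : 'M[K]_n :=
  let c := shift_coefs g in
  \matrix_(i, j)
    if j == ord0 then (if i == ord0 then 1 else c (inord i.-1) 0)
    else if (i == ord_max) && (j < m)%N then horner_sum_col g (c ord0 0) n j
    else g i j.

Definition unstraighten y : 'M[K]_n :=
  let x := y (inord 1) ord0 in
  \matrix_(i, j)
    if j == ord0 then
      x ^+ i + \sum_j' y (rowJ j') ord0 * horner_sum_col y x i (colJ j')
    else if (i == ord_max) && (j < m)%N then y i j - x * horner_sum_col y x n' j
    else y i j.

(** In the first column the entries below row [m] would be the [c_k] with
    [m <= k], which vanish on the chart. *)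
Definition free_entry (i j : 'I_n) : bool := (j < i)%N && ((j != ord0) || (i <= m)%N).

Definition straight_model : set 'M[K]_n :=
  [set y : 'M[K]_n | (forall i j, ~~ free_entry i j -> y i j = (i == j)%:R) /\
     y (inord 1) ord0 ^+ n + \sum_j y (rowJ j) ord0 * y ord_max (colJ j) = 0].

Lemma colJ_neq0 j : (colJ j == ord0) = false.
Proof. by apply/negbTE; rewrite -val_eqE /= colJE. Qed.

Lemma colJ_lt j : (colJ j < m)%N.
Proof. by rewrite colJE; have := ltn_ord j; lia. Qed.

Lemma rowJ_neq0 j : (rowJ j == ord0) = false.
Proof. by apply/negbTE; rewrite -val_eqE /= rowJE. Qed.

Lemma inord0 : inord 0 = ord0 :> 'I_n. Proof. by apply: val_inj; rewrite /= inordK. Qed.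

Lemma inord_max : inord n' = ord_max :> 'I_n. Proof. by apply: val_inj; rewrite /= inordK. Qed.

Lemma inord_neq_max l : (l < n')%N -> (inord l == ord_max :> 'I_n) = false.
Proof. by move=> ln; apply/negbTE; rewrite -val_eqE /= inordK; lia. Qed.

Lemma straighten_x g : straighten g (inord 1) ord0 = shift_coefs g ord0 0.
Proof.
rewrite mxE /= (_ : (_ == _) = false) ?inordK ?inord0 //; first by lia.
by apply/negbTE; rewrite -val_eqE /= inordK; lia.
Qed.

Lemma straighten_row g j : straighten g (rowJ j) ord0 = shift_coefs g (colJ j) 0.
Proof. by rewrite mxE /= rowJ_neq0 rowJE. Qed.

Lemma straighten_col g j :
  straighten g ord_max (colJ j) = horner_sum_col g (shift_coefs g ord0 0) n (colJ j).
Proof. by rewrite mxE /= colJ_neq0 eqxx colJ_lt. Qed.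

Lemma straighten_above g l j : (l < n')%N -> j != ord0 ->
  straighten g (inord l) j = g (inord l) j.
Proof. by move=> ln /negbTE j0; rewrite mxE j0 inord_neq_max. Qed.

Lemma unstraighten_above y l j : (l < n')%N -> j != ord0 ->
  unstraighten y (inord l) j = y (inord l) j.
Proof. by move=> ln /negbTE j0; rewrite mxE j0 inord_neq_max. Qed.

Lemma not_special (i j : 'I_n) : (i <= j)%N -> (i == ord_max) && (j < m)%N = false.
Proof.
by move=> ij; apply/negP => /andP[/eqP im jm]; move: ij; rewrite im /=; lia.
Qed.

Lemma straighten_model g : Hess_chart Nil (hess_fun n m) g ->
  straight_model (straighten g).
Proof.
move=> Hg; have [g1 g0] := Hg.1; have c0 := (chart_shift_coefs Hg.1).1 Hg.
split=> [i j|].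
  rewrite /free_entry mxE /=; have [->|j0] := eqVneq j ord0.
    have [//|i0] := eqVneq i ord0; rewrite -val_eqE /= in i0.
    rewrite lt0n i0 -ltnNge => mi; apply: c0; rewrite inordK; first by lia.
    by have := ltn_ord i; lia.
  rewrite andbT -leqNgt => ij; rewrite not_special //.
  by have [->|ij'] := eqVneq i j; [exact: g1|apply: g0; rewrite ltn_neqAle ij'].
rewrite straighten_x; under eq_bigr => j _ do rewrite straighten_row straighten_col.
by rewrite -(shift_entry_closed Hg (leqnn n)) /shift_entry ltnn.
Qed.

Lemma straightenK g : Hess_chart Nil (hess_fun n m) g ->
  unstraighten (straighten g) = g.
Proof.
move=> Hg; apply/matrixP => i j; rewrite mxE /= straighten_x.
have [->|j0] := eqVneq j ord0.
  have Ei := shift_entry_closed Hg (ltnW (ltn_ord i)).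
  rewrite /shift_entry ltn_ord inord_val in Ei; rewrite [RHS]Ei; congr (_ + _).
  apply: eq_bigr => k _; rewrite straighten_row; congr (_ * _).
  apply: eq_horner_sum_col => l li; apply: straighten_above; rewrite ?colJ_neq0 //.
  by have := ltn_ord i; lia.
rewrite mxE (negbTE j0) /=; case ijm: ((i == ord_max) && _) => //.
have /andP[/eqP -> _] := ijm.
rewrite horner_sum_colS inord_max.
rewrite (@eq_horner_sum_col (straighten g) g) => [|l ln]; last exact: straighten_above.
by rewrite addrC addKr.
Qed.

Section Unstraighten.
Variable y : 'M[K]_n.
Hypothesis Yy : straight_model y.
Local Notation x := (y (inord 1) ord0).

Let yE i j : ~~ free_entry i j -> y i j = (i == j)%:R. Proof. exact: Yy.1. Qed.

Lemma unstraighten_lower : lower_unipotent (unstraighten y).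
Proof.
have H (i j : 'I_n) : (i <= j)%N -> unstraighten y i j = (i == j)%:R.
  move=> ij; rewrite mxE /=; have [j0|j0] := eqVneq j ord0.
    have -> : i = ord0 by apply: val_inj; move: ij; rewrite j0 /=; lia.
    rewrite j0 eqxx expr0 big1 ?addr0 // => k _.
    by rewrite /horner_sum_col big_ord0 mulr0.
  by rewrite not_special // yE // /free_entry ltnNge ij.
split=> [i|i j ij]; first by rewrite H ?eqxx.
have ijF : (i == j) = false by apply: contraTF ij => /eqP ->; rewrite ltnn.
by rewrite (H i j (ltnW ij)) ijF.
Qed.

Let c : 'cV[K]_n := \col_(k < n) if (k < m)%N then y (inord k.+1) ord0 else 0.

(** The first column of [unstraighten y] is the solution of the recurrence with
    coefficients [c]; the equation of the model says that its next value, past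
    the last row, is [0], as it is for the nilpotent shift. *)
Lemma unstraighten_coefs : shift_coefs (unstraighten y) = c.
Proof.
apply/esym/shift_coefs_unique; first exact: unstraighten_lower.
apply/matrixP => i k; rewrite ord1 nilpotent_colE mxE.
rewrite sum_head; last by move=> l ml; rewrite [c _ _]mxE ltnNge ml mulr0.
rewrite [c ord0 0]mxE ltnW // (eq_bigr (fun j => unstraighten y i (colJ j) * y (rowJ j) ord0));
  last by move=> j _; rewrite [c _ _]mxE colJ_lt colJE.
have E : unstraighten y i ord0 * x +
    \sum_j unstraighten y i (colJ j) * y (rowJ j) ord0 =
  x ^+ i.+1 + \sum_j y (rowJ j) ord0 *
    (x * horner_sum_col y x i (colJ j) + unstraighten y i (colJ j)).
  rewrite mxE eqxx /= mulrDl -exprSr -addrA; congr (_ + _).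
  rewrite mulr_suml -big_split; apply: eq_bigr => j _ /=; ring.
rewrite E /shift_entry; case: ifP => [iN|/negbT iN].
  rewrite mxE eqxx /= inordK //; congr (_ + _); apply: eq_bigr => j _.
  congr (_ * _); rewrite horner_sum_colS inord_val; congr (_ + _).
  rewrite -[i in LHS]inord_val unstraighten_above ?colJ_neq0 ?inord_val //.
have im : i = ord_max by apply: val_inj; have := ltn_ord i; rewrite /=; lia.
rewrite -[RHS]Yy.2 im; congr (_ + _); apply: eq_bigr => j _; congr (_ * _).
by rewrite mxE colJ_neq0 eqxx colJ_lt addrC subrK.
Qed.

Lemma unstraighten_chart : Hess_chart Nil (hess_fun n m) (unstraighten y).
Proof.
apply/chart_shift_coefs; first exact: unstraighten_lower.
by move=> k mk; rewrite unstraighten_coefs mxE ltnNge mk.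
Qed.

Lemma unstraightenK : straighten (unstraighten y) = y.
Proof.
have cx : c ord0 0 = x by rewrite mxE ltnW.
apply/matrixP => i j; rewrite mxE /= unstraighten_coefs cx.
have [->|j0] := eqVneq j ord0.
  have [->|i0] := eqVneq i ord0; first by rewrite yE // eqxx.
  have i1 : i.-1.+1 = i by rewrite prednK // lt0n.
  rewrite mxE inordK; last by have := ltn_ord i; lia.
  rewrite i1 inord_val; case: ifP => // /negbT im; rewrite yE ?(negbTE i0) //.
  by rewrite /free_entry eqxx /=; lia.
case: ifP => [/andP[/eqP -> jm]|ijm]; last by rewrite mxE (negbTE j0) ijm.
rewrite horner_sum_colS inord_max [unstraighten y ord_max j]mxE (negbTE j0) eqxx jm /=.
rewrite (@eq_horner_sum_col (unstraighten y) y) => [|l ln]; last exact: unstraighten_above.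
by rewrite addrC subrK.
Qed.

End Unstraighten.

(** If the [c_j] with [0 < j] vanish, the equation reduces to [c_0 ^+ n = 0], so
    the recurrence has only the zero solution after its first term and each Horner
    sum reduces to the last entry of its column. *)
Lemma straighten_singular g :
  (Hess_chart Nil (hess_fun n m) g /\
   forall j, straighten g (rowJ j) ord0 = 0 /\ straighten g ord_max (colJ j) = 0) <->
  [/\ lower_unipotent g,
      forall i j : 'I_n, (2 <= i.+1 <= n)%N -> j.+1 = 1%N -> g i j = 0 &
      forall i j : 'I_n, i.+1 = n -> (2 <= j.+1 <= m)%N -> g i j = 0].
Proof.
split=> [[Hg gJ]|[lg gcol grow]].
  have cJ j : shift_coefs g (colJ j) 0 = 0 by rewrite -straighten_row; exact: (gJ j).1.
  have := (straighten_model Hg).2; rewrite straighten_x big1 => [|j _]; last first.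
    by rewrite (gJ j).1 mul0r.
  rewrite addr0 => /eqP; rewrite expf_eq0 /= => /eqP x0.
  have gi (i : 'I_n) : (0 < i)%N -> g i ord0 = 0.
    move=> i0; have := shift_entry_closed Hg (ltnW (ltn_ord i)).
    rewrite /shift_entry ltn_ord inord_val x0 expr0n eqn0Ngt i0 /= add0r => ->.
    by apply: big1 => j _; rewrite cJ mul0r.
  split; first exact: Hg.1.
    move=> i j /andP[i1 _] [j0]; rewrite (_ : j = ord0) ?gi //; last exact: val_inj.
  move=> i j [im] /andP[j1 jm]; have -> : i = ord_max by apply: val_inj.
  have jJ : (j.-1 < m.-1)%N by lia.
  have -> : j = colJ (Ordinal jJ) by apply: val_inj; rewrite /= colJE /=; lia.
  have := (gJ (Ordinal jJ)).2.
  by rewrite straighten_col x0 horner_sum_colS mul0r add0r inord_max.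
have c0 : shift_coefs g = 0.
  apply/esym/shift_coefs_unique => //; rewrite mulmx0; apply/matrixP => i k.
  rewrite ord1 nilpotent_colE mxE /shift_entry; case: ifP => // iN.
  by rewrite gcol // inordK.
split; first by apply/chart_shift_coefs => // k _; rewrite c0 mxE.
move=> j; rewrite straighten_row straighten_col c0 !mxE; split=> //.
rewrite horner_sum_colS mul0r add0r inord_max grow //.
by rewrite colJE; have := ltn_ord j; lia.
Qed.

Section Polynomiality.
Variables (N : nat) (F : 'rV[K]_N -> 'M[K]_n).
Hypothesis PF : forall i j, polynomial_fun (fun p => F p i j).

Lemma polynomial_eq (G H : 'rV[K]_N -> K) : G =1 H -> polynomial_fun G -> polynomial_fun H.
Proof. by move=> GH [f Hf]; exists f => p; rewrite -GH. Qed.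

Lemma polynomial_shift_coefs k : polynomial_fun (fun p => shift_coefs (F p) k 0).
Proof.
have Padj i j : polynomial_fun (fun p => (\adj (F p)) i j).
  apply: (@polynomial_eq (fun p => (-1) ^+ (j + i) *
    \det (\matrix_(a, b) F p (lift j a) (lift i b)))).
    move=> p; rewrite mxE /cofactor; congr (_ * \det _).
    by apply/matrixP => a b; rewrite !mxE.
  by apply: polynomialM; [exact: polynomial_cst|apply: polynomial_det => a b; exact: PF].
apply: (@polynomial_eq (fun p => \sum_i (\adj (F p)) k i *
  \sum_l Nil i l * F p l ord0)).
  move=> p; rewrite mxE; apply: eq_bigr => i _; congr (_ * _).
  by rewrite mxE; apply: eq_bigr => l _; rewrite [col _ _ _ _]mxE.
apply: polynomial_sum => i; apply: polynomialM; first exact: Padj.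
by apply: polynomial_sum => l; apply: polynomialM; [exact: polynomial_cst|exact: PF].
Qed.

Lemma polynomial_horner_sum_col X i j : polynomial_fun X ->
  polynomial_fun (fun p => horner_sum_col (F p) (X p) i j).
Proof.
by move=> PX; apply: polynomial_sum => l; apply: polynomialM; [exact: polynomialXn|exact: PF].
Qed.

Lemma polynomial_straighten i j : polynomial_fun (fun p => straighten (F p) i j).
Proof.
apply: (@polynomial_eq (fun p =>
    if j == ord0 then (if i == ord0 then 1 else shift_coefs (F p) (inord i.-1) 0)
    else if (i == ord_max) && (j < m)%N then
      horner_sum_col (F p) (shift_coefs (F p) ord0 0) n j
    else F p i j)).
  by move=> p; rewrite [RHS]mxE.
case: (j == ord0).
  by case: (i == ord0); [exact: polynomial_cst|exact: polynomial_shift_coefs].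
case: (_ && _); last exact: PF.
exact/polynomial_horner_sum_col/polynomial_shift_coefs.
Qed.

Lemma polynomial_unstraighten i j : polynomial_fun (fun p => unstraighten (F p) i j).
Proof.
apply: (@polynomial_eq (fun p =>
    if j == ord0 then F p (inord 1) ord0 ^+ i + \sum_j' F p (rowJ j') ord0 *
      horner_sum_col (F p) (F p (inord 1) ord0) i (colJ j')
    else if (i == ord_max) && (j < m)%N then
      F p i j - F p (inord 1) ord0 * horner_sum_col (F p) (F p (inord 1) ord0) n' j
    else F p i j)).
  by move=> p; rewrite [RHS]mxE.
have Px := PF (inord 1) ord0; case: (j == ord0).
  apply: polynomialD; first exact: polynomialXn.
  apply: polynomial_sum => j'; apply: polynomialM; first exact: PF.
  exact: polynomial_horner_sum_col.
case: (_ && _); last exact: PF.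
apply: polynomialB; first exact: PF.
by apply: polynomialM => //; exact: polynomial_horner_sum_col.
Qed.

End Polynomiality.
End Coordinates.

(** * The singular locus of the chart *)

Lemma mxvec_index_inj (r s : nat) (i i' : 'I_r) (j j' : 'I_s) :
  mxvec_index i j = mxvec_index i' j' -> i = i' /\ j = j'.
Proof. by move=> /cast_ord_inj/enum_rank_inj[-> ->]. Qed.

Section ChartSingularLocus.
Variables (K : numFieldType) (n' m : nat).
Local Notation n := n'.+1.
Hypotheses (m_gt1 : (1 < m)%N) (m_le : (m <= n')%N).

Local Notation chart := (Hess_chart (regular_nilpotent K n) (hess_fun n m)).

Definition free_coords : {set 'I_(n * n)} :=
  [set k | [exists i : 'I_n, exists j : 'I_n, free_entry m i j && (k == mxvec_index i j)]].

Lemma mem_free_coords i j : (mxvec_index i j \in free_coords) = free_entry m i j.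
Proof.
rewrite inE; apply/existsP/idP => [[i' /existsP[j' /andP[fij /eqP]]]|fij].
  by move=> /mxvec_index_inj[-> ->].
by exists i; apply/existsP; exists j; rewrite fij eqxx.
Qed.

Local Notation straight := (model n free_coords (mxvec (1%:M : 'M[K]_n))
  (mxvec_index (inord 1) ord0) (fun j => mxvec_index (@rowJ n' m j) ord0)
  (fun j => mxvec_index ord_max (@colJ n' m j))).

Lemma straight_modelE (y : 'M[K]_n) : straight (mxvec y) <-> straight_model m y.
Proof.
have quadE : quadric n (mxvec_index (inord 1) ord0)
    (fun j => mxvec_index (@rowJ n' m j) ord0)
    (fun j => mxvec_index ord_max (@colJ n' m j)) (mxvec y) =
  y (inord 1) ord0 ^+ n + \sum_j y (@rowJ n' m j) ord0 * y ord_max (@colJ n' m j).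
  by rewrite /quadric mxvecE; congr (_ + _); apply: eq_bigr => j _; rewrite !mxvecE.
split=> [[yb yq]|[yb yq]].
  split=> [i j fij|]; last by rewrite -quadE.
  by have := yb (mxvec_index i j); rewrite mem_free_coords fij !mxvecE mxE => ->.
split=> [k|]; last by rewrite quadE.
by case/mxvec_indexP: k => i j; rewrite mem_free_coords => fij; rewrite !mxvecE yb // mxE.
Qed.

Lemma straight_singular_locus : singular_locus straight =
  [set p | straight p /\ forall j,
     p 0 (mxvec_index (@rowJ n' m j) ord0) = 0 /\
     p 0 (mxvec_index ord_max (@colJ n' m j)) = 0].
Proof.
have j0 : 'I_m.-1 by apply: (@Ordinal _ 0); lia.
have in1 : (inord 1 : 'I_n) = 1%N :> nat by rewrite inordK //; lia.
have colE := colJE m_gt1 m_le; have rowE := rowJE m_gt1 m_le.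
apply: (model_singular_locus j0); rewrite ?mem_free_coords.
- by rewrite /free_entry eqxx /= in1; lia.
- by move=> j; rewrite mem_free_coords /free_entry eqxx rowE /=; have := ltn_ord j; lia.
- move=> j; rewrite mem_free_coords /free_entry (colJ_neq0 m_gt1 m_le) /= andbT colE.
  by have := ltn_ord j; lia.
- move=> i j /mxvec_index_inj[/(congr1 val)/=]; rewrite !rowE => -[E] _.
  exact: val_inj.
- move=> i j /mxvec_index_inj[_ /(congr1 val)/=]; rewrite !colE => -[E].
  exact: val_inj.
- move=> j; apply/eqP => /mxvec_index_inj[/(congr1 val)/=]; rewrite rowE in1.
  by [].
- move=> j; apply/eqP => /mxvec_index_inj[_ /eqP].
  by rewrite eq_sym (colJ_neq0 m_gt1 m_le).
- move=> i j; apply/eqP => /mxvec_index_inj[_ /eqP].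
  by rewrite eq_sym (colJ_neq0 m_gt1 m_le).
- lia.
Qed.

Lemma chart_singular_locus : matrix_singular_locus chart =
  [set g : 'M[K]_n |
     [/\ lower_unipotent g,
         forall i j : 'I_n, (2 <= i.+1 <= n)%N -> j.+1 = 1%N -> g i j = 0 &
         forall i j : 'I_n, i.+1 = n -> (2 <= j.+1 <= m)%N -> g i j = 0]].
Proof.
have Pvec i j : polynomial_fun (fun p : 'rV[K]_(n * n) => vec_mx p i j).
  apply: (@polynomial_eq _ _ (fun p : 'rV[K]_(n * n) => p 0 (mxvec_index i j))).
    by move=> p; rewrite mxE.
  exact: polynomial_coord.
have Pmx (F : 'rV[K]_(n * n) -> 'M[K]_n) :
    (forall i j, polynomial_fun (fun p => F p i j)) ->
    exists P, (fun p => mxvec (F p)) =1 poly_map P.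
  move=> PF; apply: poly_mapP => k; case/mxvec_indexP: k => i j.
  by apply: polynomial_eq (PF i j) => p; rewrite mxvecE.
have [P HP] := Pmx _ (polynomial_straighten m Pvec).
have [Q HQ] := Pmx _ (polynomial_unstraighten m Pvec).
have XY p : (mxvec @` chart) p -> straight (poly_map P p) /\ poly_map Q (poly_map P p) = p.
  move=> [g Hg <-]; rewrite -HP mxvecK -HQ mxvecK straightenK //; split=> //.
  by apply/straight_modelE/straighten_model.
have YX q : straight q -> (mxvec @` chart) (poly_map Q q) /\ poly_map P (poly_map Q q) = q.
  rewrite -[q]vec_mxK => /straight_modelE Yy.
  rewrite -HQ mxvecK -HP mxvecK unstraightenK //; split=> //.
  by exists (unstraighten m (vec_mx q)) => //; exact: unstraighten_chart.
have cY := @model_closed K (n * n) n _ free_coords (mxvec (1%:M : 'M[K]_n))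
  (mxvec_index (inord 1) ord0) (fun j => mxvec_index (@rowJ n' m j) ord0)
  (fun j => mxvec_index ord_max (@colJ n' m j)).
have cX := iso_closed XY YX cY.
have sing p : (mxvec @` chart) p ->
    regular_point (mxvec @` chart) p <-> regular_point straight (poly_map P p).
  move=> Xp; split; first exact: iso_regular XY YX cX cY _ Xp.
  have [Yp {2}<-] := XY p Xp; exact: iso_regular YX XY cY cX _ Yp.
apply/seteqP; split => g.
  move=> [Xg Sg]; apply/(straighten_singular m_gt1 m_le).
  have Hg : chart g by have [g' Hg' /(can_inj mxvecK) <-] := Xg.
  split=> // j.
  have : singular_locus straight (poly_map P (mxvec g)).
    by split; [have [] := XY _ Xg|move=> /(sing _ Xg)].
  by rewrite straight_singular_locus -HP mxvecK => -[_ /(_ j)]; rewrite !mxvecE.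
move=> /(straighten_singular m_gt1 m_le)[Hg gJ].
have Xg : (mxvec @` chart) (mxvec g) by exists g.
split=> // /(sing _ Xg); have [Yg _] := XY _ Xg.
suff : singular_locus straight (poly_map P (mxvec g)) by case.
rewrite straight_singular_locus; split=> // j.
by rewrite -HP mxvecK !mxvecE; exact: gJ.
Qed.

End ChartSingularLocus.

Theorem theorem1p5 (R : realType) (n m : nat) (hm : (2 <= m <= n - 1)%N) :
  matrix_singular_locus
    (Hess_chart (regular_nilpotent R[i] n) (hess_fun n m)) =
  [set g : 'M[R[i]]_n |
     [/\ lower_unipotent g,
         forall i j : 'I_n, (2 <= i.+1 <= n)%N -> j.+1 = 1%N -> g i j = 0 &
         forall i j : 'I_n, i.+1 = n -> (2 <= j.+1 <= m)%N -> g i j = 0]].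
Proof.
case: n hm => [|n'] /andP[m_gt1]; first by case: m m_gt1.
rewrite subn1 /= => m_le; exact: chart_singular_locus.
Qed.
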